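(* There is an algorithm that, given a set $\mathcal{R}$ of rules on a finite set $Q$ with $n=|Q|$ and $l=l(\mathcal{R})$, enumerates all members of $\mathcal{A}(\mathcal{R})$ (each exactly once) with $O(nl)$ delay between consecutive outputs.
   Context: A rule on $Q$ is a pair $(A,q)$ with $A\subseteq Q$, $q\in Q$; it accepts $Y\subseteq Q$ if $q\in Y$ implies $Y\cap A\neq\emptyset$. $\mathcal{K}(\mathcal{R})$ is the family of subsets accepted by all rules of $\mathcal{R}$, and $\mathcal{A}(\mathcal{R})$ is the family of $K\in\mathcal{K}(\mathcal{R})$ for which there is a sequence $\emptyset=Y_0\subseteq\dots\subseteq Y_k=K$ of members of $\mathcal{K}(\mathcal{R})$ with $|Y_{i+1}\setminus Y_i|=1$. $l(\mathcal{R})=\sum_{(A,q)\in\mathcal{R}}(|A|+1)$, assumed to satisfy $l(\mathcal{R})\ge n$. *)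

(* Defs.v *)
From mathcomp Require Import all_boot.
Set Implicit Arguments. Unset Strict Implicit. Unset Printing Implicit Defensive.

Notation rule n := ({set 'I_n} * 'I_n)%type.

Definition accepts n (r : rule n) (Y : {set 'I_n}) : bool :=
  (r.2 \in Y) ==> (Y :&: r.1 != set0).

Definition inK n (R : seq (rule n)) (Y : {set 'I_n}) : bool :=
  all (fun r => accepts r Y) R.

Definition onestep n (Y Z : {set 'I_n}) : bool :=
  (Y \subset Z) && (#|Z :\: Y| == 1).

Definition inA n (R : seq (rule n)) (K : {set 'I_n}) : Prop :=
  exists s : seq {set 'I_n},
    [/\ path (@onestep n) set0 s, last set0 s = K & all (inK R) (set0 :: s)].

Definition lR n (R : seq (rule n)) : nat := \sum_(r <- R) (#|r.1| + 1).

Inductive instr :=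
| IConst of nat & nat
| IAdd   of nat & nat & nat
| ISub   of nat & nat & nat
| ILoad  of nat & nat
| IStore of nat & nat
| IJz    of nat & nat
| IJmp   of nat
| IOut   of nat & nat.

Definition config := (nat * (nat -> nat))%type.

Definition upd (m : nat -> nat) (r v : nat) : nat -> nat :=
  fun i => if i == r then v else m i.

Definition step (P : seq instr) (c : config)
  : option (config * nat * option (seq nat)) :=
  let: (pc, m) := c in
  if pc < size P then
    match nth (IJmp 0) P pc with
    | IConst r k => Some ((pc.+1, upd m r k), 1, None)
    | IAdd r a b => Some ((pc.+1, upd m r (m a + m b)), 1, None)
    | ISub r a b => Some ((pc.+1, upd m r (m a - m b)), 1, None)
    | ILoad r a => Some ((pc.+1, upd m r (m (m a))), 1, None)
    | IStore a r => Some ((pc.+1, upd m (m a) (m r)), 1, None)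
    | IJz a t => Some ((if m a == 0 then t else pc.+1, m), 1, None)
    | IJmp t => Some ((t, m), 1, None)
    | IOut a len =>
        Some ((pc.+1, m), (m len).+1, Some [seq m (m a + i) | i <- iota 0 (m len)])
    end
  else None.

Fixpoint run (P : seq instr) (fuel : nat) (c : config)
  : seq (nat * option (seq nat)) * config :=
  match fuel with
  | 0 => ([::], c)
  | f.+1 =>
      match step P c with
      | None => ([::], c)
      | Some (c', cost, o) => let: (ev, cf) := run P f c' in ((cost, o) :: ev, cf)
      end
  end.

Definition halted (P : seq instr) (c : config) : bool :=
  if step P c is None then true else false.

(* Total cost spent before the first output, between consecutive outputs,
   and after the last output (until halting); the cost of an output
   instruction is charged to the gap it closes. *)
Fixpoint gaps (acc : nat) (ev : seq (nat * option (seq nat))) : seq nat :=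
  match ev with
  | [::] => [:: acc]
  | (c, None) :: t => gaps (acc + c) t
  | (c, Some _) :: t => (acc + c) :: gaps 0 t
  end.

Definition outputs (ev : seq (nat * option (seq nat))) : seq (seq nat) :=
  pmap snd ev.

Definition encode n (R : seq (rule n)) : seq nat :=
  n :: size R ::
    flatten [seq (nat_of_ord r.2 :: #|r.1| :: map (@nat_of_ord n) (enum r.1)) | r : rule n <- R].

Definition init n (R : seq (rule n)) : config :=
  (0, fun i => nth 0 (encode R) i).

Definition decode n (v : seq nat) : {set 'I_n} := [set i : 'I_n | val i \in v].

(* Main.v *)
Require Import Defs.
From mathcomp Require Import all_boot.
From mathcomp Require Import zify.
Set Implicit Arguments. Unset Strict Implicit. Unset Printing Implicit Defensive.

(* The accessible sets are the leaves of a binary tree: a node is a pair (K, X) with K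
   accessible and X disjoint from K, and stands for the accessible sets that contain K and
   avoid X.  If some q outside K and X can be added to K, the node branches on q; otherwise
   K is the only set it stands for, because the first element outside K of a chain from the
   empty set would be such a q.  The depth is at most n, every inner node has two nonempty
   subtrees, and one pass over the rules finds q, so O(n) node visits of cost O(l) separate
   two outputs.

   A long input fills every cell that an instruction can address directly, and no cell beyond
   it can be computed without scratch space.  One cell can be freed since the
   number M of rules is redundant up to one bit: beyond the input the memory reads as rules
   (0, empty), and this rule occurs at most once.  Cell 2 thus takes 2 q + M, with q the head
   of the first rule, cell 1 takes the constant 1, and a loop packs cells 2 and 3 into
   u = a + (n + 1) (2 q + M), with a the size of the first rule body.  Since 16 u exceeds the
   length of the input, everything can be moved to addresses above 16 u; a scan of the rules
   then yields M or M - 1, and the parity of what remains of 2 q + M decides. *)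

(** * Structured programs *)

Definition memory := nat -> nat.

Inductive com :=
| Blk of seq instr
| Out of nat & nat
| Seq of com & com
| If of nat & com & com
| While of nat & com.

Definition simple (i : instr) : bool :=
  match i with IJz _ _ | IJmp _ | IOut _ _ => false | _ => true end.

Definition eval1 (m : memory) (i : instr) : memory :=
  match i with
  | IConst r k => upd m r k
  | IAdd r a b => upd m r (m a + m b)
  | ISub r a b => upd m r (m a - m b)
  | ILoad r a => upd m r (m (m a))
  | IStore a r => upd m (m a) (m r)
  | _ => m
  end.

Definition evalb (m : memory) (s : seq instr) : memory := foldl eval1 m s.

Definition event := (nat * option (seq nat))%type.

(** Traces contain the unit cost of every jump that [compile] inserts: the tests, the jump over the
    second branch of a conditional, the jump back of a loop. Compiled code reproduces them exactly,
    so delays can be bounded at this level. *)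
Inductive exec : com -> memory -> seq event -> memory -> Prop :=
| EBlk s m : all simple s -> exec (Blk s) m (nseq (size s) (1, None)) (evalb m s)
| EOut a l m :
    exec (Out a l) m [:: ((m l).+1, Some [seq m (m a + i) | i <- iota 0 (m l)])] m
| ESeq c d m e1 m1 e2 m2 :
    exec c m e1 m1 -> exec d m1 e2 m2 -> exec (Seq c d) m (e1 ++ e2) m2
| EIfT r c d m e m' : m r != 0 -> exec c m e m' ->
    exec (If r c d) m ((1, None) :: rcons e (1, None)) m'
| EIfF r c d m e m' : m r = 0 -> exec d m e m' ->
    exec (If r c d) m ((1, None) :: e) m'
| EWhile0 r c m : m r = 0 -> exec (While r c) m [:: (1, None)] m
| EWhile1 r c m e1 m1 e2 m2 : m r != 0 ->
    exec c m e1 m1 -> exec (While r c) m1 e2 m2 ->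
    exec (While r c) m ((1, None) :: e1 ++ (1, None) :: e2) m2.

Fixpoint compile (pc : nat) (c : com) : seq instr :=
  match c with
  | Blk s => s
  | Out a l => [:: IOut a l]
  | Seq c d => compile pc c ++ compile (pc + size (compile pc c)) d
  | If r c d =>
      let x := compile pc.+1 c in
      let y := compile (pc + size x).+2 d in
      IJz r (pc + size x).+2 :: x ++ IJmp ((pc + size x).+2 + size y) :: y
  | While r c =>
      let x := compile pc.+1 c in IJz r (pc + size x).+2 :: x ++ [:: IJmp pc]
  end.

Definition steps (P : seq instr) (c : config) (ev : seq event) (c' : config) : Prop :=
  exists f, run P f c = (ev, c').

Lemma run_add P f g c :
  run P (f + g) c =
  ((run P f c).1 ++ (run P g (run P f c).2).1, (run P g (run P f c).2).2).
Proof.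
elim: f c => [|f IH] c; first by rewrite add0n /=; case: run.
rewrite addSn /=; case E: (step P c) => [[[c' k] o]|] /=.
  by rewrite IH; case: (run P f c') => e1 c1 /=; case: (run P g c1).
by case: g {IH} => [|g] //=; rewrite E.
Qed.

Lemma steps_trans P c e1 c1 e2 c2 :
  steps P c e1 c1 -> steps P c1 e2 c2 -> steps P c (e1 ++ e2) c2.
Proof. by move=> [f Ef] [g Eg]; exists (f + g); rewrite run_add Ef /= Eg. Qed.

Lemma steps_refl P c : steps P c [::] c. Proof. by exists 0. Qed.

Lemma steps1 P c c' k o : step P c = Some (c', k, o) -> steps P c [:: (k, o)] c'.
Proof. by move=> E; exists 1 => /=; rewrite E. Qed.

Definition code_at (P : seq instr) (pc : nat) (s : seq instr) : Prop :=
  exists x y, P = x ++ s ++ y /\ size x = pc.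

Lemma code_at_cat P pc s t :
  code_at P pc (s ++ t) -> code_at P pc s /\ code_at P (pc + size s) t.
Proof.
move=> [x [y [-> <-]]]; split; first by exists x, (t ++ y); rewrite -!catA.
by exists (x ++ s), y; rewrite size_cat -!catA.
Qed.

Lemma code_at_cons P pc i t :
  code_at P pc (i :: t) ->
  [/\ pc < size P, nth (IJmp 0) P pc = i & code_at P pc.+1 t].
Proof.
move=> [x [y [-> <-]]]; split; first by rewrite !size_cat /=; lia.
- by rewrite nth_cat ltnn subnn.
- by exists (rcons x i), y; rewrite size_rcons cat_rcons.
Qed.

Lemma step_simple P pc i m : pc < size P -> nth (IJmp 0) P pc = i -> simple i ->
  step P (pc, m) = Some ((pc.+1, eval1 m i), 1, None).
Proof. by rewrite /step => -> ->; case: i. Qed.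

(** By induction on the derivation, not on the program, because a further iteration of a loop runs
    the same code again. *)
Lemma comp_correct P c m ev m' : exec c m ev m' ->
  forall pc, code_at P pc (compile pc c) ->
  steps P (pc, m) ev (pc + size (compile pc c), m').
Proof.
elim=> {c m ev m'}.
- move=> s m; elim: s m => [|i s IH] m /=.
    by move=> _ pc _; rewrite addn0; exact: steps_refl.
  move=> /andP[si ss] pc /code_at_cons[lt Ei C].
  rewrite -cat1s addnS -addSn; apply: steps_trans (steps1 (step_simple m lt Ei si)) _.
  exact: IH.
- move=> a l m pc /code_at_cons[lt Ei _] /=; rewrite addn1.
  by apply: steps1; rewrite /step lt Ei.
- move=> c d m e1 m1 e2 m2 _ IH1 _ IH2 pc /= /code_at_cat[C1 C2].
  by rewrite size_cat addnA; apply: steps_trans (IH1 _ C1) (IH2 _ C2).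
- move=> r c d m e m' nz _ IH pc /= /code_at_cons[lt Ei /code_at_cat[C1]].
  move=> /code_at_cons[lt2 Ei2 _].
  rewrite -cat1s -cats1; apply: steps_trans (steps1 (c' := (pc.+1, m)) _) _.
    by rewrite /step lt Ei (negbTE nz).
  apply: steps_trans (IH _ C1) _.
  apply: steps1; rewrite /step lt2 Ei2 size_cat /=.
  by congr (Some (_, _, _, _)); lia.
- move=> r c d m e m' z _ IH pc /= /code_at_cons[lt Ei /code_at_cat[_]].
  move=> /code_at_cons[_ _]; rewrite addSn => C.
  rewrite -cat1s; apply: steps_trans (steps1 (c' := ((pc + size (compile pc.+1 c)).+2, m)) _) _.
    by rewrite /step lt Ei z.
  rewrite size_cat /=; set x := (_ + _.+1).
  rewrite (_ : x = (pc + size (compile pc.+1 c)).+2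
       + size (compile (pc + size (compile pc.+1 c)).+2 d)); last by rewrite /x; lia.
  exact: IH.
- move=> r c m z pc /= /code_at_cons[lt Ei _]; apply: steps1.
  by rewrite /step lt Ei z size_cat /=; congr (Some (_, _, _, _)); lia.
- move=> r c m e1 m1 e2 m2 nz _ IH1 _ IH2 pc /= C.
  have [lt Ei /code_at_cat[C1 /code_at_cons[lt2 Ei2 _]]] := code_at_cons C.
  rewrite -cat1s; apply: steps_trans (steps1 (c' := (pc.+1, m)) _) _.
    by rewrite /step lt Ei (negbTE nz).
  apply: steps_trans (IH1 _ C1) _; rewrite -cat1s.
  apply: steps_trans (steps1 (c' := (pc, m1)) _) (IH2 _ C).
  by rewrite /step lt2 Ei2.
Qed.

Lemma comp_run c m ev m' : exec c m ev m' ->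
  exists f, let x := run (compile 0 c) f (0, m) in x.1 = ev /\ halted (compile 0 c) x.2.
Proof.
move=> E; have [|f Ef] := comp_correct E (P := compile 0 c) (pc := 0).
  by exists [::], [::]; rewrite cats0.
by exists f; rewrite /= Ef /halted /step /= add0n ltnn.
Qed.

(** * Cost-bounded total correctness of silent programs *)

Definition cost (ev : seq event) : nat := \sum_(e <- ev) e.1.

(** A total-correctness triple with a cost bound. Outputs are excluded, so the whole cost falls into
    one gap and a single number describes it. *)
Definition sx (c : com) (m : memory) (k : nat) (Q : memory -> Prop) : Prop :=
  exists ev m', [/\ exec c m ev m', outputs ev = [::], cost ev <= k & Q m'].

Lemma cost_cat e1 e2 : cost (e1 ++ e2) = cost e1 + cost e2.
Proof. by rewrite /cost big_cat. Qed.

Lemma outputs_cat e1 e2 : outputs (e1 ++ e2) = outputs e1 ++ outputs e2.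
Proof. exact: pmap_cat. Qed.

Lemma sx_weak c m k k' (Q Q' : memory -> Prop) : sx c m k Q -> k <= k' ->
  (forall m', Q m' -> Q' m') -> sx c m k' Q'.
Proof.
move=> [ev [m' [E O C q]]] le H; exists ev, m'; split=> //; last exact: H.
exact: leq_trans le.
Qed.

Lemma sx_blk s m (Q : memory -> Prop) : all simple s -> Q (evalb m s) -> sx (Blk s) m (size s) Q.
Proof.
move=> S q; exists (nseq (size s) (1, None)), (evalb m s); split=> //; first exact: EBlk.
  by elim: (s).
by rewrite /cost big_nseq iter_addn_0 mul1n.
Qed.

Lemma sx_seq c d m k1 k2 (Q : memory -> Prop) :
  sx c m k1 (fun m1 => sx d m1 k2 Q) -> sx (Seq c d) m (k1 + k2) Q.
Proof.
move=> [e1 [m1 [E1 O1 C1 [e2 [m2 [E2 O2 C2 q]]]]]].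
exists (e1 ++ e2), m2; split=> //; first exact: ESeq E1 E2.
  by rewrite outputs_cat O1 O2.
by rewrite cost_cat leq_add.
Qed.

Lemma sx_while0 r c m (Q : memory -> Prop) : m r = 0 -> Q m -> sx (While r c) m 1 Q.
Proof.
move=> z q; exists [:: (1, None)], m; split=> //; first exact: EWhile0.
by rewrite /cost big_seq1.
Qed.

Lemma sx_while1 r c m k1 k2 (Q : memory -> Prop) : m r != 0 ->
  sx c m k1 (fun m1 => sx (While r c) m1 k2 Q) -> sx (While r c) m (k1 + k2 + 2) Q.
Proof.
move=> nz [e1 [m1 [E1 O1 C1 [e2 [m2 [E2 O2 C2 q]]]]]].
exists ((1, None) :: e1 ++ (1, None) :: e2), m2; split=> //; first exact: EWhile1 E1 E2.
  by rewrite /= outputs_cat O1 /= O2.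
rewrite -cat1s -[_ :: e2]cat1s !cost_cat {1 3}/cost !big_seq1 /=; lia.
Qed.

(** Indexing the invariant by the number of iterations left gives termination and cost at once: 2
    pays for the test and the jump back, the final 1 for the failing test. *)
Lemma sx_while r c k (I : nat -> memory -> Prop) i m :
  (forall m, I 0 m -> m r = 0) ->
  (forall i m, I i.+1 m -> m r != 0 /\ sx c m k (I i)) ->
  I i m -> sx (While r c) m (i * (k + 2) + 1) (I 0).
Proof.
move=> H0 H; elim: i m => [|i IH] m Im; first exact: sx_while0 (H0 _ Im) Im.
have [nz S] := H _ _ Im.
rewrite (_ : _ + 1 = k + (i * (k + 2) + 1) + 2); last by lia.
by apply: sx_while1 => //; apply: sx_weak S _ _ => // m'; apply: IH.
Qed.

Lemma updS m r v : upd m r v r = v. Proof. by rewrite /upd eqxx. Qed.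
Lemma updD m r v a : a != r -> upd m r v a = m a. Proof. by rewrite /upd => /negbTE->. Qed.

(** * Lists in memory and symbolic evaluation of blocks *)

Definition seg (m : memory) (p : nat) (s : seq nat) : Prop :=
  forall i, i < size s -> m (p + i) = nth 0 s i.

Lemma seg_cat m p s t : seg m p (s ++ t) <-> seg m p s /\ seg m (p + size s) t.
Proof.
split=> [H|[H1 H2] i].
  split=> i lt; first by rewrite H ?nth_cat ?lt // size_cat; lia.
  by rewrite -addnA H ?nth_cat ?size_cat; [rewrite ifF; [congr nth; lia | lia] | lia].
rewrite size_cat nth_cat => lt; case: ifP => lt2; first exact: H1.
by rewrite -H2; [congr m; lia | lia].
Qed.

Lemma seg_cons m p x s : seg m p (x :: s) <-> m p = x /\ seg m p.+1 s.
Proof.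
rewrite -cat1s seg_cat /= addn1; split=> -[H1 H2]; split=> //.
  by rewrite -[p]addn0 H1.
by case=> // _; rewrite addn0.
Qed.

Lemma eq_seg m m' p s : (forall i, i < size s -> m' (p + i) = m (p + i)) -> seg m p s -> seg m' p s.
Proof. by move=> E H i lt; rewrite E // H. Qed.

Lemma updE m r v a : a = r -> upd m r v a = v. Proof. by move=> ->; exact: updS. Qed.

(** A read is resolved only once its address and that of the write contain no [upd], so indirect
    addresses are normalised before [lia] compares them. *)
Ltac upd_step :=
  match goal with
  | |- context [upd ?m ?r ?v ?a] =>
      lazymatch r with context [upd] => fail | _ => idtac end;
      lazymatch a with context [upd] => fail | _ => idtac end;
      first [ rewrite (@updD m r v a); [|by [] || lia]
            | rewrite (@updE m r v a); [|reflexivity || lia] ]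
  end.
Lemma evalb_cons m i s : evalb m (i :: s) = evalb (eval1 m i) s. Proof. by []. Qed.
Lemma evalb_nil m : evalb m [::] = m. Proof. by []. Qed.
Ltac upds :=
  repeat (rewrite evalb_cons; cbn [eval1]; repeat upd_step);
  rewrite ?evalb_nil; repeat upd_step.

Definition erule (r : nat * seq nat) : seq nat := r.1 :: size r.2 :: r.2.
Definition erules (rs : seq (nat * seq nat)) : seq nat := flatten (map erule rs).
Definition weight (rs : seq (nat * seq nat)) : nat := \sum_(r <- rs) (size r.2 + 1).

(** * Visiting a node *)

(* Registers: 0 = n, 1 = F (the input is at F), 2 = the constant 1, 4 = number of rules,
   5 = 2F, 6 = 3F, 7 = 4F, 8 = 5F, 9 = depth, 10 = 1 to descend and 0 to backtrack,
   11 = loop guard, 12 to 20 = scratch.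
   Arrays: 2F = status of each element (0 undecided, 1 excluded, 2 taken), 3F = nonzero
   where an element cannot be chosen, with a zero sentinel at index n, 4F = stack of
   decisions, 5F = output buffer. *)
Definition copy_body : seq instr :=
  [:: IAdd 19 5 12; ILoad 20 19; IAdd 19 6 12; IStore 19 20; IAdd 12 12 2; ISub 14 14 2].
Definition copy_st : com :=
  Seq (Blk [:: IConst 12 0; IAdd 14 0 12]) (While 14 (Blk copy_body)).

(** With truncated subtraction, [(e - q) + (q - e)] is the distance of [e] and [q], so 1 minus it
    tests equality; the status minus 1 is nonzero only for a taken element. Register 17 accumulates
    both tests. *)
Definition elem_body : seq instr :=
  [:: ILoad 18 13; IAdd 13 13 2; ISub 19 18 15; ISub 20 15 18; IAdd 19 19 20;
      ISub 19 2 19; IAdd 17 17 19; IAdd 19 5 18; ILoad 20 19; ISub 20 20 2;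
      IAdd 17 17 20; ISub 16 16 2].
(** Once the body is read, 1 minus register 17 is 1 exactly when no element of it helps; this is
    added to the mark of the head. *)
Definition rule_body : com :=
  Seq (Blk [:: ILoad 15 13; IAdd 13 13 2; ILoad 16 13; IAdd 13 13 2; IConst 17 0])
  (Seq (While 16 (Blk elem_body))
       (Blk [:: ISub 17 2 17; IAdd 19 6 15; ILoad 20 19; IAdd 20 20 17; IStore 19 20;
                ISub 14 14 2])).
Definition block_rules : com :=
  Seq (Blk [:: IConst 13 2; IAdd 13 13 1; IConst 14 0; IAdd 14 14 4])
      (While 14 rule_body).

(** Register 20 ends as n minus the index found, hence 0 exactly when the scan stopped at the
    sentinel. *)
Definition find_free : com :=
  Seq (Blk [:: IConst 12 0; ILoad 20 6])
  (Seq (While 20 (Blk [:: IAdd 12 12 2; IAdd 19 6 12; ILoad 20 19]))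
       (Blk [:: ISub 20 0 12])).

Definition push : seq instr :=
  [:: IAdd 19 7 9; IStore 19 12; IAdd 19 5 12; IConst 20 2; IStore 19 20; IAdd 9 9 2].

(** Every index is written at the end of the buffer, but the end advances only past a taken one;
    other entries get overwritten or stay outside the output. *)
Definition gather_body : seq instr :=
  [:: IAdd 19 8 13; IStore 19 12; IAdd 19 5 12; ILoad 20 19; ISub 20 20 2;
      IAdd 13 13 20; IAdd 12 12 2; ISub 14 14 2].
Definition gather : com :=
  Seq (Blk [:: IConst 12 0; IConst 13 0; IConst 14 0; IAdd 14 14 0])
      (While 14 (Blk gather_body)).

(** Decrementing the top status serves both cases. From 2 to 1, the element becomes excluded, the
    depth stays and the mode turns to descending; from 1 to 0, the decision is popped and
    backtracking goes on. *)
Definition back : seq instr :=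
  [:: ISub 19 9 2; IAdd 19 19 7; ILoad 12 19; IAdd 19 5 12; ILoad 20 19; ISub 20 20 2;
      IStore 19 20; IConst 10 0; IAdd 10 10 20; ISub 20 2 20; ISub 9 9 20].

Definition search : com := Seq copy_st (Seq block_rules find_free).
Definition emit : com := Seq gather (Seq (Out 8 13) (Blk [:: IConst 10 0])).
Definition node : com := Seq search (If 20 (Blk push) emit).
(** The guard, depth plus mode, vanishes exactly when backtracking has reached the empty stack. *)
Definition visit : com := Seq (If 10 node (Blk back)) (Blk [:: IAdd 11 9 10]).

(** * Correctness of the blocks of a visit *)

Section Machine.
Variables (n F : nat) (rs : seq (nat * seq nat)).
Hypotheses (F24 : 24 <= F) (ltnF : n < F) (szF : size (erules rs) + 2 <= F).
Hypothesis rs_lt : all (fun r => (r.1 < n) && all (fun e => e < n) r.2) rs.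

(* The cells not used as scratch space during the search for a free element. *)
Definition core (a : nat) : bool := (a < 12) || (F <= a < 3 * F) || (4 * F <= a < 5 * F).
Definition eqc (m m' : memory) : Prop := forall a, core a -> m' a = m a.

Record base (m : memory) : Prop := Base {
  base0 : m 0 = n; base1 : m 1 = F; base2 : m 2 = 1; base4 : m 4 = size rs;
  base5 : m 5 = 2 * F; base6 : m 6 = 3 * F; base7 : m 7 = 4 * F; base8 : m 8 = 5 * F;
  base_rules : seg m (F + 2) (erules rs) }.

Lemma eqc_trans m1 m2 m3 : eqc m1 m2 -> eqc m2 m3 -> eqc m1 m3.
Proof. by move=> H1 H2 a ca; rewrite H2 // H1. Qed.

Lemma eqc_base m m' : eqc m m' -> base m -> base m'.
Proof.
move=> E [*]; split; rewrite ?E //.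
apply: eq_seg; last eassumption.
by move=> i lt; apply: E; rewrite /core; lia.
Qed.

Lemma copy_stP m : base m ->
  sx copy_st m (2 + (n * 8 + 1)) (fun m' => [/\ eqc m m',
    forall i, i < n -> m' (3 * F + i) = m (2 * F + i) & m' (3 * F + n) = m (3 * F + n)]).
Proof.
move=> B; apply: sx_seq; apply: sx_blk => //.
pose I i m' := [/\ eqc m m', m' 14 = i, m' 12 + i = n,
  forall j, j < m' 12 -> m' (3 * F + j) = m (2 * F + j) & m' (3 * F + n) = m (3 * F + n)].
apply: (@sx_weak _ _ _ _ (I 0)) (leqnn _) _; last first.
  by move=> m' [H1 H2 H3 H4 H5]; split=> // i lt; apply: H4; lia.
apply: (@sx_while 14 _ 6 I n) => [m2 [] //|i m2 [E E14 E12 C S]|]; last first.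
  have [B0 B1 B2 B4 B5 B6 B7 B8 _] := B.
  split; try (by upds; lia).
  - by move=> a; rewrite /core => ca; upds.
split; first by rewrite E14.
have [B0 B1 B2 B4 B5 B6 B7 B8 _] := eqc_base E B.
apply: (@sx_blk copy_body) => //; split.
- by move=> a ca; rewrite -E //; move: ca; rewrite /core => ca; upds.
- by upds; lia.
- by upds; lia.
- move=> j; upds => lt.
  have [lj|->] : j < m2 12 \/ j = m2 12 by lia.
    by upds; exact: C.
  by upds; rewrite B5 E // /core; lia.
- by upds.
Qed.

(** The body [es] misses the taken set enlarged by [q], so a rule with head [q] and this body
    forbids adding [q]. *)
Definition unhit (q : nat) (m : memory) (es : seq nat) : bool :=
  all (fun e => (e != q) && (m (2 * F + e) <= 1)) es.

Lemma elem_loopP es m : m 2 = 1 -> m 5 = 2 * F -> 24 <= m 13 ->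
  m 16 = size es -> seg m (m 13) es ->
  sx (While 16 (Blk elem_body)) m (size es * 14 + 1) (fun m' => [/\
    forall a, a < 13 \/ a = 14 \/ a = 15 \/ 20 < a -> m' a = m a,
    m' 13 = m 13 + size es & (m' 17 == 0) = (m 17 == 0) && unhit (m 15) m es]).
Proof.
elim: es m => [|e es IH] m E2 E5 ge E16.
  by move=> _; apply: sx_while0 => //; split=> //; rewrite ?addn0 ?andbT.
move=> /seg_cons[Ee S].
rewrite (_ : _ + 1 = 12 + (size es * 14 + 1) + 2); last by rewrite /=; lia.
apply: sx_while1; first by rewrite E16.
apply: (@sx_blk elem_body) => //.
set m1 := evalb _ _.
have E1 a : a < 13 \/ a = 14 \/ a = 15 \/ 20 < a -> m1 a = m a.
  by move=> H; rewrite /m1; upds.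
have E13 : m1 13 = (m 13).+1 by rewrite /m1; upds; lia.
have E16' : m1 16 = size es by rewrite /m1; upds; rewrite E16 /=; lia.
have E17 : (m1 17 == 0) = (m 17 == 0) && ((e != m 15) && (m (2 * F + e) <= 1)).
  by rewrite /m1; upds; rewrite Ee E5 E2; lia.
have := IH m1; rewrite (E1 2 ltac:(lia)) (E1 5 ltac:(lia)) (E1 15 ltac:(lia)).
rewrite E13 E17 => /(_ E2 E5 _ E16') H.
apply: sx_weak (H _ _) (leqnn _) _; first lia.
  by apply: eq_seg S => i lt; apply: E1; lia.
move=> m' [H1 H2 H3]; split.
- by move=> a Ha; rewrite H1 // E1.
- by rewrite H2 /=; lia.
rewrite H3 -andbA; congr (_ && _); rewrite /unhit /=; congr (_ && _).
by apply: eq_in_all => x _; rewrite E1 //; lia.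
Qed.

Definition blocked (i : nat) (m : memory) (s : seq (nat * seq nat)) : bool :=
  has (fun r => (r.1 == i) && unhit i m r.2) s.

Lemma rule_loopP s m : m 2 = 1 -> m 5 = 2 * F -> m 6 = 3 * F ->
  F <= m 13 -> m 13 + size (erules s) <= 2 * F -> m 14 = size s ->
  all (fun r => (r.1 < n) && all (fun e => e < n) r.2) s ->
  seg m (m 13) (erules s) ->
  sx (While 14 rule_body) m (weight s * 40 + 1) (fun m' => [/\ eqc m m',
    forall i, i < n -> (m' (3 * F + i) == 0) = (m (3 * F + i) == 0) && ~~ blocked i m s
    & m' (3 * F + n) = m (3 * F + n)]).
Proof.
elim: s m => [|[q es] s IH] m E2 E5 E6 ge le E14.
  by move=> _ _; rewrite /weight big_nil; apply: sx_while0 => //; split=> // i _; rewrite andbT.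
move=> /= /andP[/andP[ltq lte] lts]; rewrite /erules /= in le *.
rewrite -/(erules s) size_cat /= in le *.
move=> /seg_cons[Eq] /seg_cons[Ea] /seg_cat[Ses Ss].
rewrite /weight big_cons /= -/(weight s).
(* A rule with body size a costs 14 a + 14: blocks of 5 and 6 instructions, the inner loop, and the
   two jumps of the outer loop. This is at most 40 (a + 1). *)
apply: (@sx_weak _ _ (5 + (size es * 14 + 1 + 6) + (weight s * 40 + 1) + 2)); last 2 first.
- by lia.
- by move=> m'; exact.
apply: sx_while1; first by rewrite E14.
apply: sx_seq; apply: sx_blk => //; set m1 := evalb _ _.
have E1 a : a < 13 \/ a = 14 \/ 20 < a -> m1 a = m a.
  by move=> H; rewrite /m1; upds.
have E13 : m1 13 = (m 13).+2 by rewrite /m1; upds; lia.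
have E15 : m1 15 = q by rewrite /m1; upds; rewrite Eq; lia.
have E16 : m1 16 = size es by rewrite /m1; upds; rewrite E2 addn1 Ea.
have E17 : m1 17 = 0 by rewrite /m1; upds.
apply: sx_seq; have := @elem_loopP es m1.
rewrite (E1 2 ltac:(lia)) (E1 5 ltac:(lia)) E13 => /(_ E2 E5 _ E16) H; apply: sx_weak (H _ _) (leqnn _) _; first lia.
  by apply: eq_seg Ses => i lt; apply: E1; lia.
move=> {H} m2 [H1 H2 H3].
apply: sx_blk => //; set m3 := evalb _ _.
have e6 : m2 6 = 3 * F by rewrite H1 ?E1 //; lia.
have e15 : m2 15 = q by rewrite H1 ?E15 //; lia.
have e2 : m2 2 = 1 by rewrite H1 ?E1 //; lia.
have E2' a : a < 13 \/ 20 < a -> a != 3 * F + q -> m3 a = m a.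
  move=> Ha Hq; rewrite /m3; upds.
  by rewrite H1 ?E1; lia.
have E3q : m3 (3 * F + q) = m (3 * F + q) + (1 - m2 17).
  by rewrite /m3; upds; rewrite e6 e15 e2 H1 ?E1; lia.
have E3 : eqc m m3 by move=> a; rewrite /core => ca; apply: E2'; lia.
have E313 : m3 13 = (m 13).+2 + size es by rewrite /m3; upds; rewrite H2.
have E314 : m3 14 = size s.
  by rewrite /m3; upds; rewrite !H1 ?E1; rewrite ?E14 ?E2 /=; lia.
have := IH m3; rewrite (E2' 2 ltac:(lia) ltac:(lia)) (E2' 5 ltac:(lia) ltac:(lia)).
rewrite (E2' 6 ltac:(lia) ltac:(lia)) E313 => /(_ E2 E5 E6 _ _ E314 lts) H.
apply: sx_weak (H _ _ _) (leqnn _) _; try lia.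
  by apply: eq_seg Ss => i lt; apply: E2'; lia.
move=> m' [G1 G2 G3]; split; [exact: eqc_trans E3 G1 | | by rewrite G3 E2' //; lia].
have EU i r : all (fun e => e < n) r -> unhit i m3 r = unhit i m r.
  move=> /allP A; apply: eq_in_all => x /A lt; rewrite E2' //; lia.
have EB i : blocked i m3 s = blocked i m s.
  by apply: eq_in_has => -[q' r] /(allP lts) /andP[_ A] /=; rewrite EU.
move=> i lti; rewrite G2 // EB /blocked /= negb_or andbA; congr (_ && _).
case: (eqVneq q i) => [Eqi|ne] /=; last by rewrite E2' ?andbT //; lia.
subst i; rewrite E3q addn_eq0; congr (_ && _).
move: H3; rewrite E17 E15 /= => H3.
have -> : unhit q m es = unhit q m1 es.
  by move/allP: lte => A; apply: eq_in_all => x /A lt; rewrite E1 //; lia.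
by rewrite -H3; case: (m2 17).
Qed.

Lemma block_rulesP m : base m ->
  sx block_rules m (4 + (weight rs * 40 + 1)) (fun m' => [/\ eqc m m',
    forall i, i < n -> (m' (3 * F + i) == 0) = (m (3 * F + i) == 0) && ~~ blocked i m rs
    & m' (3 * F + n) = m (3 * F + n)]).
Proof.
move=> [B0 B1 B2 B4 B5 B6 B7 B8 S]; apply: sx_seq; apply: sx_blk => //.
set m1 := evalb _ _.
have E1 a : a < 13 \/ a = 15 \/ 20 < a -> m1 a = m a by move=> H; rewrite /m1; upds.
have E13 : m1 13 = F + 2 by rewrite /m1; upds; lia.
have E14 : m1 14 = size rs by rewrite /m1; upds; lia.
have := @rule_loopP rs m1.
rewrite (E1 2 ltac:(lia)) (E1 5 ltac:(lia)) (E1 6 ltac:(lia)) E13.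
move=> /(_ B2 B5 B6 _ _ E14 rs_lt) H.
apply: sx_weak (H _ _ _) (leqnn _) _; try lia.
  by apply: eq_seg S => i lt; apply: E1; lia.
have E : eqc m m1 by move=> a; rewrite /core => ca; apply: E1; lia.
move=> m' [G1 G2 G3]; split; [exact: eqc_trans E G1 | | by rewrite G3 E1 //; lia].
move=> i lti; rewrite G2 // E1; last lia.
congr (_ && ~~ _).
apply: eq_in_has => -[q es] /(allP rs_lt) /andP[_ /allP A] /=; congr (_ && _).
by apply: eq_in_all => x /A lt; rewrite E1 //; lia.
Qed.

Lemma find_freeP m (b : pred nat) : base m ->
  (forall i, i < n -> b i = (m (3 * F + i) == 0)) -> m (3 * F + n) = 0 ->
  sx find_free m (2 + (n * 5 + 1 + 1)) (fun m' => [/\ eqc m m', m' (3 * F + n) = 0,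
    m' 12 = find b (iota 0 n) & m' 20 = n - m' 12]).
Proof.
move=> B Hb Hn; apply: sx_seq; apply: sx_blk => //.
set f := find _ _; have fn : f <= n by have := find_size b (iota 0 n); rewrite size_iota.
apply: sx_seq.
pose I i m' := [/\ eqc m m', forall a, 20 < a -> m' a = m a,
  m' 12 + i = f & m' 20 = m (3 * F + m' 12)].
have [B0 B1 B2 B4 B5 B6 B7 B8 _] := B.
apply: (@sx_weak _ _ (f * (3 + 2) + 1) _ (I 0)) => [||m' [H1 HF H2 H3]]; last first.
- apply: sx_blk => //; split.
  + by move=> a ca; rewrite -H1 //; move: ca; rewrite /core => ca; upds.
  + by upds; rewrite HF //; lia.
  + by upds; lia.
  + by upds; rewrite H1 ?B0.
- by lia.
apply: (@sx_while 20 _ 3 I f) => [m2 [E EF E12 E20]|i m2 [E EF E12 E20]|].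
- rewrite E20 addn0 in E12 *; rewrite E12.
  (* If nothing is free the scan stops at index n, on the zero sentinel. *)
  have [->//|lt] : f = n \/ f < n by lia.
  have := nth_find 0 (s := iota 0 n) (a := b); rewrite -/f has_find size_iota => /(_ lt).
  by rewrite nth_iota // Hb // => /eqP.
- have [B0' B1' B2' B4' B5' B6' B7' B8' _] := eqc_base E B.
  have lt : m2 12 < f by lia.
  split.
    rewrite E20 -Hb; last by lia.
    have := before_find 0 lt; rewrite nth_iota ?add0n; last by lia.
    by move=> ->.
  apply: (@sx_blk [:: _; _; _]) => //; split.
  + by move=> a ca; rewrite -E //; move: ca; rewrite /core => ca; upds.
  + by move=> a ca; rewrite -EF //; upds.
  + by upds; lia.
  + upds; rewrite B6' EF //; lia.
- split; try (by upds; lia).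
  + by move=> a; rewrite /core => ca; upds.
  + by move=> a ca; upds.
  + by upds; rewrite B6 addn0.
Qed.

(* A stack of decisions (element, taken or not), the latest first. *)
Fixpoint status (D : seq (nat * bool)) (q : nat) : nat :=
  if D is (x, b) :: D' then if q == x then b.+1 else status D' q else 0.

Lemma status0 D q : (status D q == 0) = (q \notin map fst D).
Proof. by elim: D => [|[x b] D IH] //=; rewrite inE negb_or -IH; case: (q =P x). Qed.

Lemma status_le D q : status D q <= 2.
Proof. by elim: D => [|[x b] D IH] //=; case: eqP => // _; case: b. Qed.

(** Only rules with head [i] are tested: a rule with another head that accepts the taken set still
    accepts it with [i] added. *)
Definition free (D : seq (nat * bool)) (i : nat) : bool :=
  (status D i == 0) &&
  ~~ has (fun r => (r.1 == i) && all (fun e => (e != i) && (status D e <= 1)) r.2) rs.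

Definition next_free (D : seq (nat * bool)) : nat := find (free D) (iota 0 n).

Definition leaf (D : seq (nat * bool)) : seq nat := [seq q <- iota 0 n | status D q == 2].

(** The fuel [h] never cuts a branch short when [size D + h = n], because at depth n every element
    is decided. *)
Fixpoint leaves (h : nat) (D : seq (nat * bool)) : seq (seq nat) :=
  if h is h'.+1 then
    if next_free D < n then leaves h' ((next_free D, true) :: D) ++ leaves h' ((next_free D, false) :: D)
    else [:: leaf D]
  else [:: leaf D].

Definition proper_stack (D : seq (nat * bool)) : bool :=
  uniq (map fst D) && all (fun x => x < n) (map fst D).

Lemma proper_stack_size D : proper_stack D -> size D <= n.
Proof.
case/andP=> U /allP A; rewrite -(size_map fst) -[leqRHS](size_iota 0).
by apply: uniq_leq_size => // x /A; rewrite mem_iota.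
Qed.

Lemma next_freeP D : next_free D < n -> free D (next_free D).
Proof.
move=> lt; have := nth_find 0 (s := iota 0 n) (a := free D).
by rewrite has_find size_iota -/(next_free D) nth_iota // => /(_ lt).
Qed.

Lemma proper_push D b : proper_stack D -> next_free D < n -> proper_stack ((next_free D, b) :: D).
Proof.
by case/andP=> U A lt; rewrite /proper_stack /= U A lt -status0; case/andP: (next_freeP lt) => ->.
Qed.

(** Otherwise pushing the free element would give n + 1 distinct elements below n. *)
Lemma next_free_full D : proper_stack D -> size D = n -> next_free D = n.
Proof.
move=> P E; have := find_size (free D) (iota 0 n); rewrite size_iota -/(next_free D).
rewrite leq_eqVlt => /orP[/eqP //|lt]; have := proper_stack_size (proper_push true P lt).
by rewrite /= E ltnn.
Qed.

(** * Machine states that represent a decision stack *)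

Record state (mode : nat) (D : seq (nat * bool)) (m : memory) : Prop := State {
  st_base : base m; st_depth : m 9 = size D; st_mode : m 10 = mode;
  st_status : forall i, i < n -> m (2 * F + i) = status D i;
  st_stack : seg m (4 * F) (rev (map fst D)); st_guard : m (3 * F + n) = 0 }.

Lemma state_eqc mode D m m' : proper_stack D -> eqc m m' -> m' (3 * F + n) = m (3 * F + n) ->
  state mode D m -> state mode D m'.
Proof.
move=> /proper_stack_size P E G [S1 S2 S3 S4 S5 S6]; split; rewrite ?G ?E //.
- exact: eqc_base S1.
- by move=> i lt; rewrite E ?S4 // /core; lia.
apply: eq_seg S5 => i; rewrite size_rev size_map => lt; apply: E; rewrite /core; lia.
Qed.

Lemma searchP mode D m : proper_stack D -> state mode D m ->
  sx search m (weight rs * 40 + n * 13 + 12)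
    (fun m' => [/\ state mode D m', m' 12 = next_free D & m' 20 = n - next_free D]).
Proof.
move=> P S; have B := st_base S.
rewrite (_ : _ + 12 =
  2 + (n * 8 + 1) + (4 + (weight rs * 40 + 1) + (2 + (n * 5 + 1 + 1)))); last by lia.
apply: sx_seq; apply: sx_weak (copy_stP B) (leqnn _) _ => m1 [E1 C1 G1].
have B1 := eqc_base E1 B.
apply: sx_seq; apply: sx_weak (block_rulesP B1) (leqnn _) _ => m2 [E2 C2 G2].
have B2 := eqc_base E2 B1.
have S2 : state mode D m2.
  by apply: state_eqc (eqc_trans E1 E2) _ S => //; rewrite G2.
apply: (@sx_weak _ _ _ _ _ _ (@find_freeP m2 (free D) B2 _ _)) (leqnn _) _.
- move=> i lt; rewrite C2 // C1 // (st_status S) // /free /blocked; congr (_ && ~~ _).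
  apply: eq_in_has => -[q es] /(allP rs_lt) /andP[_ /allP A] /=; congr (_ && _).
  apply: eq_in_all => x /A ltx; rewrite E1 ?(st_status S) //.
  by rewrite /core; lia.
- exact: st_guard S2.
move=> m3 [E3 G3 E12 E20]; split=> //; last by rewrite E20 E12.
by apply: (state_eqc P E3 _ S2); rewrite G3 (st_guard S2).
Qed.

Lemma pushP D m : proper_stack D -> next_free D < n -> state 1 D m -> m 12 = next_free D ->
  state 1 ((next_free D, true) :: D) (evalb m push).
Proof.
move=> P lt [B S2 S3 S4 S5 S6] E12; have sz := proper_stack_size (proper_push true P lt).
rewrite /= in sz.
have [B0 B1 B2 B4 B5 B6 B7 B8 BR] := B.
split; try (by upds; rewrite /=; lia).
- split; try (by upds; lia).
  by apply: eq_seg BR => i lti; upds.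
- move=> i lti /=; case: eqP => [->|ne]; upds => //.
  exact: S4.
- rewrite /= rev_cons -cats1; apply/seg_cat; split.
    apply: eq_seg S5 => i; rewrite size_rev size_map => lti; upds => //.
  apply/seg_cons; rewrite size_rev size_map; split=> //.
  by upds.
Qed.

Lemma backP q b D m : proper_stack ((q, b) :: D) -> state 0 ((q, b) :: D) m ->
  state b (if b then (q, false) :: D else D) (evalb m back).
Proof.
move=> P [B S2 S3 S4 S5 S6].
have sz := proper_stack_size P; rewrite /= in sz.
have [B0 B1 B2 B4 B5 B6 B7 B8 BR] := B.
have [ltq nq] : q < n /\ q \notin map fst D.
  by case/andP: P => /andP[-> _] /andP[-> _].
have Eq : m (4 * F + size D) = q.
  by rewrite S5 ?size_rev ?size_map /= ?nth_rev /= ?size_map // ?subnn //; lia.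
rewrite /= in S2.
have E1 : m (m 9 - m 2 + m 7) = q by rewrite -Eq; congr m; lia.
have E2 : m (2 * F + q) = b.+1 by rewrite S4 //= eqxx.
have E3 : m (m 5 + q) = b.+1 by rewrite -E2 B5.
have E4 i : i < n -> i != q -> m (2 * F + i) = status D i.
  by move=> lti ne; rewrite S4 //= (negbTE ne).
set m' := evalb m back.
have [F1 F2 F3 F4] : [/\ m' 9 = size D + b, m' 10 = b, m' (2 * F + q) = b
    & forall a, (a < 9) || (20 < a) -> a != 2 * F + q -> m' a = m a].
  by split; [rewrite /m'; upds; rewrite E1 E3; case: (b); lia
            |rewrite /m'; upds; rewrite E1 E3; case: (b); lia
            |rewrite /m'; upds; rewrite E1 E3; case: (b); lia
            |move=> a lta ne; rewrite /m'; upds].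
have S5' : seg m' (4 * F) (rev (q :: map fst D)).
  by apply: eq_seg S5 => i; rewrite size_rev /= size_map => lti; apply: F4; lia.
have B' : base m'.
  split; try (by rewrite F4 //; lia).
  by apply: eq_seg BR => i lti; apply: F4; lia.
have G' : m' (3 * F + n) = 0 by rewrite F4 //; lia.
clearbody m'; case: b {P S4 S5 S6 E2 E3 Eq E1 B} F1 F2 F3 => /= F1 F2 F3.
- split=> //; first by rewrite F1 addn1.
  by move=> i lti /=; case: eqP => [->//|/eqP ne]; rewrite F4 ?E4 //; lia.
- split=> //; first by rewrite F1 addn0.
    move=> i lti /=; have [->|ne] := eqVneq i q; last by rewrite F4 ?E4 //; lia.
    by rewrite F3; apply/esym/eqP; rewrite status0.
  by move: S5'; rewrite rev_cons -cats1 => /seg_cat[].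
Qed.

Lemma gatherP mode D m : proper_stack D -> state mode D m ->
  sx gather m (4 + (n * 10 + 1))
    (fun m' => [/\ state mode D m', seg m' (5 * F) (leaf D) & m' 13 = size (leaf D)]).
Proof.
move=> P S; apply: sx_seq; apply: sx_blk => //.
have B := st_base S; have [B0 B1 B2 B4 B5 B6 B7 B8 _] := B.
pose lf k := [seq q <- iota 0 k | status D q == 2].
pose I i m' := [/\ forall a, (a < 12) || (F <= a < 5 * F) -> m' a = m a, m' 14 = i,
  m' 12 + i = n, m' 13 = size (lf (m' 12)) & seg m' (5 * F) (lf (m' 12))].
have core_I m' : (forall a, (a < 12) || (F <= a < 5 * F) -> m' a = m a) -> state mode D m'.
  move=> E; apply: state_eqc S => //; last by apply: E; lia.
  by move=> a ca; apply: E; move: ca; rewrite /core; lia.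
apply: (@sx_weak _ _ _ _ (I 0)) (leqnn _) _; last first.
  by move=> m' [H1 H2]; rewrite addn0 => -> H4 H5; split=> //; apply: core_I.
apply: (@sx_while 14 _ 8 I n) => [m2 [] //|i m2 [E E14 E12 E13 C]|]; last first.
  split; try (by upds; lia).
  - by move=> a ca; upds.
  - by upds.
  - by upds.
split; first by rewrite E14.
have [[B0' B1' B2' B4' B5' B6' B7' B8' _] _ _ ST _ _] := core_I _ E.
have lt : m2 12 < n by lia.
have le13 : m2 13 <= m2 12.
  have := count_size (fun q => status D q == 2) (iota 0 (m2 12)).
  by rewrite E13 size_filter size_iota.
apply: (@sx_blk gather_body) => //; set m3 := evalb _ _.
have F12 : m3 12 = (m2 12).+1 by rewrite /m3; upds; lia.
have F13 : m3 13 = m2 13 + (status D (m2 12) - 1).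
  by rewrite /m3; upds; rewrite B5' ST // B2'.
have FB : m3 (5 * F + m2 13) = m2 12 by rewrite /m3; upds.
have FF a : (a < 12) || (20 < a) -> a != 5 * F + m2 13 -> m3 a = m2 a.
  by move=> Ha ne; rewrite /m3; upds.
have lfS : lf (m2 12).+1 = lf (m2 12) ++ (if status D (m2 12) == 2 then [:: m2 12] else [::]).
  by rewrite /lf -[(m2 12).+1]addn1 iotaD filter_cat /= add0n.
split.
- by move=> a ca; rewrite FF; [apply: E | lia | lia].
- by rewrite /m3; upds; lia.
- by rewrite F12; lia.
- rewrite F12 F13 lfS size_cat E13; have := status_le D (m2 12).
  by case: status => [|[|[|]]].
rewrite F12 lfS; apply/seg_cat; split.
  by apply: eq_seg C => j ltj; apply: FF; lia.
case: eqP => // _; by apply/seg_cons; rewrite -E13 FB.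
Qed.

End Machine.

(** * Traversing the tree *)

Lemma sx_ifT r c d m k (Q : memory -> Prop) : m r != 0 -> sx c m k Q -> sx (If r c d) m (k + 2) Q.
Proof.
move=> nz [e [m' [E O C q]]]; exists ((1, None) :: rcons e (1, None)), m'; split=> //.
- exact: EIfT.
- by rewrite -cats1 /= outputs_cat O.
- rewrite -cat1s -cats1 !cost_cat {1 3}/cost !big_seq1 /=; lia.
Qed.

Lemma sx_ifF r c d m k (Q : memory -> Prop) : m r = 0 -> sx d m k Q -> sx (If r c d) m (k + 1) Q.
Proof.
move=> z [e [m' [E O C q]]]; exists ((1, None) :: e), m'; split=> //; first exact: EIfF.
rewrite -cat1s !cost_cat {1}/cost !big_seq1 /=; lia.
Qed.

Lemma outputs_none c e : outputs ((c, None) :: e) = outputs e. Proof. by []. Qed.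
Lemma outputs_some c v e : outputs ((c, Some v) :: e) = v :: outputs e. Proof. by []. Qed.

(* Starting with [a] units of time already spent in the current gap, every gap
   closed by [ev] is at most [B], and at most [b] units are spent since the last output. *)
Fixpoint timed (B a : nat) (ev : seq event) (b : nat) : Prop :=
  match ev with
  | [::] => a <= b
  | (c, None) :: ev' => timed B (a + c) ev' b
  | (c, Some _) :: ev' => a + c <= B /\ timed B 0 ev' b
  end.

Lemma timed_weak B a a' ev b b' : a' <= a -> b <= b' -> timed B a ev b -> timed B a' ev b'.
Proof.
move=> la lb; elim: ev a a' la => [|[c [o|]] ev IH] a a' la /=.
- by move=> le; lia.
- by move=> [le T]; split; [lia | apply: IH T].
- by apply: IH; lia.
Qed.

Lemma timed_cat B a e1 b e2 d : timed B a e1 b -> timed B b e2 d -> timed B a (e1 ++ e2) d.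
Proof.
elim: e1 a => [|[c [o|]] e1 IH] a /=; first by move=> le; exact: timed_weak.
- by move=> [le T] T2; split=> //; exact: IH.
- exact: IH.
Qed.

Lemma timed_silent B a ev b : outputs ev = [::] -> a + cost ev <= b -> timed B a ev b.
Proof.
elim: ev a => [|[c [o|]] ev IH] a //=; first by rewrite /cost big_nil addn0.
by rewrite /cost big_cons /= => O le; apply: IH => //; rewrite /cost -addnA.
Qed.

Lemma timed_gaps B a ev b : timed B a ev b -> b <= B -> all (fun g => g <= B) (gaps a ev).
Proof.
elim: ev a => [|[c [o|]] ev IH] a /=; first by move=> le1 le2; lia.
- by move=> [-> T] le; exact: IH.
- exact: IH.
Qed.

Section Tree.
Variables (n F : nat) (rs : seq (nat * seq nat)).
Hypotheses (F24 : 24 <= F) (ltnF : n < F) (szF : size (erules rs) + 2 <= F).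
Hypothesis rs_lt : all (fun r => (r.1 < n) && all (fun e => e < n) r.2) rs.

Notation state := (state n F rs).
Notation next_free := (next_free n rs).
Notation leaf := (leaf n).
Notation leaves := (leaves n rs).
Notation pstack := (proper_stack n).

Definition live (mode : nat) D (m : memory) : Prop := state mode D m /\ m 11 = size D + mode.

Lemma liveP mode D m : pstack D -> state mode D m ->
  sx (Blk [:: IAdd 11 9 10]) m 1 (live mode D).
Proof.
move=> P S; have [B S2 S3 S4 S5 S6] := S; have sz := proper_stack_size P.
have [B0 B1 B2 B4 B5 B6 B7 B8 BR] := B.
apply: (@sx_blk [:: _]) => //; split; last by upds; lia.
split; try (by upds; lia).
- split; try (by upds; lia).
  by apply: eq_seg BR => i lti; upds.
- by move=> i lti; upds; exact: S4.
- by apply: eq_seg S5 => i; rewrite size_rev size_map => lti; upds.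
Qed.

(** A uniform bound for one visit, with or without output, including the test and the jump of the
    surrounding loop. *)
Definition vcost : nat := weight rs * 40 + n * 24 + 60.

Lemma visit_push D m : pstack D -> next_free D < n -> state 1 D m ->
  sx visit m (weight rs * 40 + n * 13 + 12 + (6 + 2) + 2 + 1)
    (live 1 ((next_free D, true) :: D)).
Proof.
move=> P lt S; apply: sx_seq; apply: sx_ifT; first by rewrite (st_mode S).
apply: sx_seq; apply: (@sx_weak _ _ _ _ _ _ (searchP F24 ltnF szF rs_lt P S)) (leqnn _) _.
move=> m1 [S1 E12 E20]; apply: sx_ifT; first by rewrite E20; lia.
apply: sx_blk => //; apply: liveP; first exact: proper_push.
exact: pushP.
Qed.

Lemma visit_back q b D m : pstack ((q, b) :: D) -> state 0 ((q, b) :: D) m ->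
  sx visit m (11 + 1 + 1) (live b (if b then (q, false) :: D else D)).
Proof.
move=> P S; apply: sx_seq; apply: sx_ifF; first by rewrite (st_mode S).
apply: sx_blk => //; apply: liveP; last exact: backP S.
by case: b P {S} => //; rewrite /proper_stack /= => /andP[/andP[_ ->] /andP[_ ->]].
Qed.

(** The only kind of visit that outputs, hence not expressible by [sx]. The 3 units after the output
    are the reset of register 10, the jump over [back] and the update of register 11. *)
Lemma visit_leaf D m : pstack D -> n <= next_free D -> state 1 D m ->
  exists ev m', [/\ exec visit m ev m', outputs ev = [:: leaf D], live 0 D m'
    & forall B a, a + (weight rs * 40 + n * 24 + 25) <= B -> timed B a ev 3].
Proof.
move=> P le S; have nz : m 10 != 0 by rewrite (st_mode S).
have [e1 [m1 [X1 O1 C1 [S1 E12 E20]]]] := searchP F24 ltnF szF rs_lt P S.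
have z : m1 20 = 0 by rewrite E20; lia.
have [e2 [m2 [X2 O2 C2 [S2 G2 E13]]]] := gatherP F24 ltnF szF rs_lt P S1.
set m3 := evalb m2 [:: IConst 10 0].
have S3 : state 0 D m3.
  have sz := proper_stack_size P.
  case: S2 => -[B0 B1 B2 B4 B5 B6 B7 B8 BR] T2 T3 T4 T5 T6.
  split; try (by rewrite /m3; upds; lia).
  - split; try (by rewrite /m3; upds; lia).
    by apply: eq_seg BR => i lti; rewrite /m3; upds.
  - by move=> i lti; rewrite /m3; upds; exact: T4.
  - by apply: eq_seg T5 => i; rewrite size_rev size_map => lti; rewrite /m3; upds.
have [e4 [m4 [X4 O4 C4 L4]]] := liveP P S3.
have X3 : exec (Blk [:: IConst 10 0]) m2 [:: (1, None)] m3 by exact: (@EBlk [:: _]).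
have out : [seq m2 (m2 8 + i) | i <- iota 0 (m2 13)] = leaf D.
  rewrite (base8 (st_base S2)) E13; apply: (@eq_from_nth _ 0); first by rewrite size_map size_iota.
  move=> i; rewrite size_map size_iota => lti.
  by rewrite (nth_map 0) ?size_iota // nth_iota // G2.
have X := ESeq (EIfT (Blk back) nz (ESeq X1
  (EIfF (Blk push) z (ESeq X2 (ESeq (EOut 8 13 m2) X3))))) X4.
have szl : size (leaf D) <= n.
  have := count_size (fun q => status D q == 2) (iota 0 n).
  by rewrite size_filter size_iota.
eexists; exists m4; split; [exact: X | | exact: L4 |].
  by rewrite -!cats1 !(outputs_cat, outputs_none, outputs_some) out O1 O2 O4.
move=> Bd a leB.
apply: (timed_cat (b := 2)); last by apply: timed_silent; rewrite // C4.
rewrite /= -cats1; apply: (timed_cat (b := 1)) => //.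
apply: (timed_cat (b := a + 1 + cost e1)); first exact: timed_silent.
rewrite /=; apply: (timed_cat (b := a + cost e1 + cost e2 + 2)).
  by apply: timed_silent => //; lia.
by rewrite /= E13; split=> //; lia.
Qed.

(** Completed iterations of the main loop without the final test, so that traversals of subtrees can
    be concatenated. *)
Inductive iter : memory -> seq event -> memory -> Prop :=
| iter0 m : iter m [::] m
| iter1 m e1 m1 e2 m2 : m 11 != 0 -> exec visit m e1 m1 -> iter m1 e2 m2 ->
    iter m ((1, None) :: e1 ++ (1, None) :: e2) m2.

Lemma iter_trans m e1 m1 e2 m2 : iter m e1 m1 -> iter m1 e2 m2 -> iter m (e1 ++ e2) m2.
Proof.
elim=> {m e1 m1} // m e1 m1 e3 m3 nz X _ IH /IH I.
rewrite [_ ++ e2](_ : _ = (1, None) :: e1 ++ (1, None) :: (e3 ++ e2)); last by rewrite /= -catA.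
exact: iter1 I.
Qed.

Lemma iter_exec m e m' : iter m e m' -> m' 11 = 0 -> exec (While 11 visit) m (e ++ [:: (1, None)]) m'.
Proof.
elim=> {m e m'} [m|m e1 m1 e2 m2 nz X _ IH z]; first exact: EWhile0.
rewrite [_ ++ _](_ : _ = (1, None) :: e1 ++ (1, None) :: (e2 ++ [:: (1, None)])).
  exact: EWhile1 (IH z).
by rewrite /= -catA.
Qed.

Lemma iter_sx m k (Q : memory -> Prop) B a : m 11 != 0 -> sx visit m k Q -> k + 2 <= vcost ->
  exists ev m', [/\ iter m ev m', outputs ev = [::], timed B a ev (a + vcost) & Q m'].
Proof.
move=> nz [e [m' [X O C q]]] le; exists ((1, None) :: e ++ [:: (1, None)]), m'; split=> //.
- by apply: iter1 X _ => //; exact: iter0.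
- by rewrite /= outputs_cat O.
apply: timed_silent; first by rewrite /= outputs_cat O.
rewrite -cat1s !cost_cat {1 3}/cost !big_seq1 /=; lia.
Qed.

(** Every subtree outputs something, so a gap never spans a whole subtree. At most h + 1 visits
    precede the first leaf and as many are charged after the last one; a gap between sibling
    subtrees is an ascent, one flip and a descent, within 2 n + 3 visits. *)
Lemma tree_run h D m B a : pstack D -> size D + h = n -> live 1 D m ->
  (2 * n + 3) * vcost <= B -> a + h.+1 * vcost <= B ->
  exists ev m', [/\ iter m ev m', outputs ev = leaves h D, live 0 D m'
    & timed B a ev (h.+1 * vcost)].
Proof.
elim: h D m a => [|h IH] D m a P szD [S E11] leB lea.
  have nz : m 11 != 0 by rewrite E11; lia.
  have [|ev [m' [X O L T]]] := visit_leaf P _ S; first by rewrite next_free_full //; lia.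
  exists ((1, None) :: ev ++ [:: (1, None)]), m'; split=> //.
  - by apply: iter1 X _ => //; exact: iter0.
  - by rewrite /= outputs_cat O.
  rewrite /=; apply: (@timed_cat _ _ _ 3); first by apply: T; rewrite /vcost in lea; lia.
  by rewrite /= /vcost; lia.
have nz : m 11 != 0 by rewrite E11; lia.
rewrite [leaves _ _]/=; case: ifP => [lt|/negbT]; last first.
  rewrite -leqNgt => le; have [ev [m' [X O L T]]] := visit_leaf P le S.
  exists ((1, None) :: ev ++ [:: (1, None)]), m'; split=> //.
  - by apply: iter1 X _ => //; exact: iter0.
  - by rewrite /= outputs_cat O.
  rewrite /=; apply: (@timed_cat _ _ _ 3); first by apply: T; rewrite /vcost in lea; lia.
  by rewrite /= /vcost; lia.
have PT := proper_push true P lt; have PF := proper_push false P lt.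
have [|e1 [m1 [I1 O1 T1 L1]]] := iter_sx B a nz (visit_push P lt S);
  first by rewrite /vcost; lia.
have [||e2 [m2 [I2 O2 [S2 E2] T2]]] := IH _ _ (a + vcost) PT _ L1 leB;
  [rewrite /=; lia | lia |].
have nz2 : m2 11 != 0 by rewrite E2.
(* The time left over from the first subtree is carried through the flip into the second. *)
have [|e3 [m3 [I3 O3 T3 L3]]] := iter_sx B (h.+1 * vcost) nz2 (visit_back PT S2);
  first by rewrite /vcost; lia.
have [||e4 [m4 [I4 O4 [S4 E4] T4]]] := IH _ _ (h.+1 * vcost + vcost) PF _ L3 leB;
  [rewrite /=; lia | nia |].
have nz4 : m4 11 != 0 by rewrite E4.
have [|e5 [m5 [I5 O5 T5 L5]]] := iter_sx B (h.+1 * vcost) nz4 (visit_back PF S4);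
  first by rewrite /vcost; lia.
exists (e1 ++ e2 ++ e3 ++ e4 ++ e5), m5; split=> //.
- exact: iter_trans I1 (iter_trans I2 (iter_trans I3 (iter_trans I4 I5))).
- by rewrite !outputs_cat O1 O2 O3 O4 O5 cats0.
apply: timed_cat T1 (timed_cat T2 (timed_cat T3 (timed_cat T4 _))).
by apply: timed_weak T5 => //; lia.
Qed.

(** The strict bound on [b] leaves room for the jump that ends the surrounding conditional. *)
Lemma main_run m B a : state 1 [::] m -> m 11 = 1 ->
  a + (3 * n + 6) * vcost <= B ->
  exists ev m', [/\ exec (While 11 visit) m ev m', outputs ev = leaves n [::]
    & exists2 b, timed B a ev b & b < B].
Proof.
move=> S E11 leB.
have vc : 60 <= vcost by rewrite /vcost; lia.
have [|||ev [m' [I O [_ L] T]]] := @tree_run n [::] m B a isT (add0n n); [by split | nia | nia |].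
exists (ev ++ [:: (1, None)]), m'; split; first exact: iter_exec.
  by rewrite outputs_cat O cats0.
exists (n.+1 * vcost + 1); last by nia.
by apply: timed_cat T _ => /=.
Qed.

End Tree.

(** * Correctness of the branching *)

Section Accessible.
Variables (n : nat) (R : seq (rule n)).

Definition raw_rule (r : rule n) : nat * seq nat := (val r.2, map val (enum r.1)).
Definition raw_rules : seq (nat * seq nat) := map raw_rule R.

Notation next_free := (next_free n raw_rules).
Notation pstack := (proper_stack n).

Definition taken (D : seq (nat * bool)) : {set 'I_n} := [set i : 'I_n | status D i == 2].

Definition compatible (D : seq (nat * bool)) (K : {set 'I_n}) : Prop :=
  forall i : 'I_n, (status D i = 2 -> i \in K) /\ (status D i = 1 -> i \notin K).

Lemma decode_leaf D : decode n (leaf n D) = taken D.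
Proof. by apply/setP => i; rewrite !inE mem_filter mem_iota /= ltn_ord andbT. Qed.

Lemma freeE D (i : 'I_n) : free raw_rules D i =
  (status D i == 0) && all (fun r : rule n => (r.2 == i) ==>
     [exists e in r.1, (e == i) || (e \in taken D)]) R.
Proof.
rewrite /free; congr (_ && _); rewrite -all_predC all_map; apply: eq_all => r /=.
rewrite negb_and -implybE; congr (_ ==> _).
rewrite -has_predC has_map; apply/hasP/existsP => [[e]|[e /andP[eA He]]].
  rewrite mem_enum => eA /= He; exists e; rewrite eA /= inE -val_eqE /=.
  by move: He; rewrite negb_and negbK -ltnNge; have := status_le D e; lia.
exists e; first by rewrite mem_enum.
move: He; rewrite /= inE -val_eqE /= negb_and negbK -ltnNge.
by case/orP => [->//|/eqP ->]; rewrite orbT.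
Qed.

Lemma onestep_setU1 (q : 'I_n) (Y : {set 'I_n}) : q \notin Y -> onestep Y (q |: Y).
Proof.
move=> nq; rewrite /onestep subsetU1 /= (_ : _ :\: _ = [set q]) ?cards1 //.
by apply/setP => x; rewrite !inE; case: eqP => [->|]; [rewrite nq | case: (x \in Y)].
Qed.

Lemma onestepP (Y Z : {set 'I_n}) : onestep Y Z -> exists q, Z = q |: Y.
Proof.
case/andP=> /subsetP sYZ /cards1P[q Eq]; exists q; apply/setP => x.
move/setP/(_ x): Eq; rewrite !inE; case: (x =P q) => [_|_] /=.
  by case/andP=> _ ->.
by case xY: (x \in Y) => /=; [move=> _; apply: sYZ | move=> ->].
Qed.

Lemma path_onestep_sub (Y : {set 'I_n}) s : path (@onestep n) Y s -> Y \subset last Y s.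
Proof.
elim: s Y => [|Z s IH] Y //= /andP[/andP[sYZ _] /IH]; exact: subset_trans.
Qed.

(** The chain for [taken D] is extended by one step. Rules with head [q] accept the new set by
    freeness, the others because [taken D] already met their bodies where required. *)
Lemma inA_push D (q : 'I_n) : inA R (taken D) -> free raw_rules D q ->
  inA R (taken ((val q, true) :: D)).
Proof.
move=> [s [ps ls Ks]]; rewrite freeE => /andP[/eqP q0 /allP fq].
have ET : taken ((val q, true) :: D) = q |: taken D.
  by apply/setP => i; rewrite !inE /= val_eqE; case: (i =P q).
exists (rcons s (taken ((val q, true) :: D))); split; rewrite ?last_rcons //.
  by rewrite rcons_path ps ls /= ET onestep_setU1 // inE q0.
rewrite -rcons_cons all_rcons Ks andbT; apply/allP => r rR.
rewrite /accepts ET; apply/implyP; rewrite !inE => /orP[/eqP Er|Er].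
  have := fq r rR; rewrite Er eqxx => /exists_inP[e eA He].
  by apply/set0Pn; exists e; rewrite !inE eA andbT; move: He; rewrite inE.
have : inK R (taken D) by move/allP: Ks; apply; rewrite -ls mem_last.
move=> /allP/(_ r rR)/implyP; rewrite inE => /(_ Er)/set0Pn[e].
rewrite inE => /andP[eT eA]; apply/set0Pn; exists e; rewrite !inE eA andbT.
by move: eT; rewrite inE => ->; rewrite orbT.
Qed.

(* The first element of the chain outside [taken D] would be free. *)
Lemma taken_unique D K : inA R K -> compatible D K -> n <= next_free D -> K = taken D.
Proof.
move=> [s [ps ls Ks]] cD nf; apply/eqP; rewrite eqEsubset; apply/andP; split; last first.
  by apply/subsetP => i; rewrite inE => /eqP; case: (cD i).
(* Induction along the chain from an arbitrary start [Y] inside [taken D]; every step must stay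
   inside. *)
have : set0 \subset taken D by rewrite sub0set.
rewrite -ls in cD *; move: ps Ks cD; rewrite /=; move: (set0 : {set 'I_n}) => Y.
elim: s Y {ls} => [|Z s IH] Y //= /andP[oYZ ps] /and3P[_ KZ Ks] cD sY.
apply: IH => //; first by rewrite KZ Ks.
have [q EZ] := onestepP oYZ; rewrite EZ subUset sY andbT sub1set.
apply: contraT => nqT.
have qK : q \in last Z s.
  by apply: (subsetP (path_onestep_sub ps)); rewrite EZ !inE eqxx.
have : ~~ free raw_rules D q.
  have := before_find 0 (s := iota 0 n) (a := free raw_rules D) (i := q).
  rewrite nth_iota // add0n => -> //.
  by apply: leq_trans nf.
(* [q] lies in K, so it is not excluded, and it is not taken by assumption. *)
have q0 : status D q == 0.
  move: nqT; rewrite inE; have := status_le D q; have := (cD q).2; rewrite qK.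
  by case: (status D q) => [|[|[|]]] // /(_ erefl).
(* Some rule with head [q] blocks it, yet Z accepts this rule, through an element that is [q] or
   already taken. *)
rewrite freeE q0 /= => /allPn[r rR]; rewrite negb_imply => /andP[/eqP rq].
move/exists_inP; case.
move/allP/(_ r rR)/implyP: KZ; rewrite rq EZ !inE eqxx => /(_ isT)/set0Pn[e].
rewrite !inE => /andP[He eA]; exists e => //.
by case/orP: He => [->//|/(subsetP sY)]; rewrite inE => ->; rewrite orbT.
Qed.

(** Membership of the branching element separates the two subtrees, which gives uniqueness and
    completeness. Both children have an accessible taken set: by [inA_push], and because exclusion
    does not change it. *)
Lemma leavesP h D : pstack D -> size D + h = n -> inA R (taken D) ->
  uniq [seq decode n v | v <- leaves n raw_rules h D] /\
  forall K, K \in [seq decode n v | v <- leaves n raw_rules h D] <->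
    inA R K /\ compatible D K.
Proof.
have one D' : inA R (taken D') -> n <= next_free D' ->
    uniq [seq decode n v | v <- [:: leaf n D']] /\
    forall K, K \in [seq decode n v | v <- [:: leaf n D']] <-> inA R K /\ compatible D' K.
  move=> tA nf; split=> // K; rewrite /= inE decode_leaf; split=> [/eqP ->|[KA cK]].
    by split=> // i; rewrite !inE; split=> [->//|->].
  by rewrite (taken_unique KA cK nf).
elim: h D => [|h IH] D P sz tA; first by apply: one => //; rewrite next_free_full //; lia.
rewrite /=; case: ifP => [lt|/negbT]; last by rewrite -leqNgt; exact: one.
have PT := proper_push true P lt; have PF := proper_push false P lt.
have fr := next_freeP lt; move: PT PF fr; set q := next_free D => PT PF fr.
have st0 : status D q = 0 by case/andP: fr => /eqP.
have [||uT mT] := IH _ PT; [by rewrite /= -sz; lia | exact: (@inA_push D (Ordinal lt)) |].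
have EF : taken ((q, false) :: D) = taken D.
  by apply/setP => i; rewrite !inE /=; case: (val i =P q) => [->|//]; rewrite st0.
have [||uF mF] := IH _ PF; [by rewrite /= -sz; lia | by rewrite EF |].
rewrite map_cat cat_uniq uT uF andbT /=; split.
  apply/hasPn => K /mF [_ /(_ (Ordinal lt)) /= [_]]; rewrite eqxx => /(_ erefl) nK.
  apply/negP => /mT [_ /(_ (Ordinal lt)) /= []]; rewrite eqxx => /(_ erefl).
  by rewrite (negbTE nK).
have cD (b : bool) K : compatible ((q, b) :: D) K <-> compatible D K /\ (Ordinal lt \in K) = b.
  split=> [c|[c Eb] i].
    split; last by have := c (Ordinal lt); rewrite /= eqxx; case: (b) => -[c1 c2];
      [apply: c1 | apply/negbTE/c2].
    move=> i; have := c i; rewrite /=; case: eqP => [E|//] _.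
    by rewrite E st0.
  have := c i; rewrite /=; case: eqP => [E|//] _.
  have -> : i = Ordinal lt by apply: val_inj.
  by rewrite Eb; case: (b).
move=> K; rewrite mem_cat; split.
  by case/orP => [/mT|/mF] [KA /cD []].
move=> [KA c]; apply/orP; case E: (Ordinal lt \in K).
  by left; apply/mT; split=> //; apply/cD.
by right; apply/mF; split=> //; apply/cD.
Qed.

Lemma inA_set0 : inA R set0.
Proof. by exists [::]; split=> //=; rewrite andbT; apply/allP => r _; rewrite /accepts inE. Qed.

Lemma leaves_enum :
  uniq [seq decode n v | v <- leaves n raw_rules n [::]] /\
  forall K, K \in [seq decode n v | v <- leaves n raw_rules n [::]] <-> inA R K.
Proof.
have T0 : taken [::] = set0 by apply/setP => i; rewrite !inE.
have [|u m] := @leavesP n [::] isT (add0n n); first by rewrite T0; exact: inA_set0.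
by split=> // K; split=> [/m []//|KA]; apply/m.
Qed.

Lemma encodeE : encode R = n :: size R :: erules raw_rules.
Proof.
rewrite /encode /erules /raw_rules -map_comp; congr (_ :: _ :: flatten _).
by apply: eq_map => r; rewrite /erule /= size_map -cardE.
Qed.

Lemma weight_raw : weight raw_rules = lR R.
Proof. by rewrite /weight /lR big_map; apply: eq_bigr => r _; rewrite /= size_map -cardE. Qed.

Lemma raw_lt : all (fun r => (r.1 < n) && all (fun e => e < n) r.2) raw_rules.
Proof.
rewrite all_map; apply/allP => r _ /=; rewrite ltn_ord /= all_map.
by apply/allP => e _ /=; apply: ltn_ord.
Qed.

(** Distinctness is what allows the number of rules to be recovered after packing. *)
Lemma uniq_raw : uniq R -> uniq raw_rules.
Proof.
move=> U; rewrite map_inj_uniq // => -[A q] [B p] [/val_inj -> /(inj_map val_inj) E].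
by congr pair; apply/setP => x; rewrite -(mem_enum A) -(mem_enum B) E.
Qed.

End Accessible.

(** * Relocating the input *)

(** Works within cells 0 to 3. As the first body has at most n elements, division by n + 1 will
    recover both packed numbers. *)
Definition pack : com :=
  Seq (Blk [:: IAdd 2 2 2; IAdd 2 2 1; IConst 1 1; IAdd 0 0 1])
      (While 2 (Blk [:: ISub 2 2 1; IAdd 3 3 0])).

Definition save_range (k j : nat) : seq instr :=
  flatten [seq [:: IStore 1 i; IAdd 1 1 2] | i <- iota k j].

(** Four doublings give 16 u. With no register free to index the source, cells 4 to 23 are copied by
    unrolled code with literal addresses; they then become registers. *)
Definition save : com :=
  Seq (Blk [:: IAdd 1 3 3; IAdd 1 1 1; IAdd 1 1 1; IAdd 1 1 1; IConst 2 1;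
               IAdd 1 1 2; IAdd 1 1 2; IAdd 1 1 2; IAdd 1 1 2])
      (Blk (save_range 4 20)).

Definition move_body : seq instr :=
  [:: ILoad 14 12; IStore 1 14; IAdd 12 12 2; IAdd 1 1 2; ISub 13 13 2].
Definition move_input : com :=
  Seq (Blk [:: IAdd 5 3 3; IAdd 5 5 5; IAdd 5 5 5; IAdd 5 5 5; IConst 12 24; ISub 13 5 12])
      (While 13 (Blk move_body)).

(** Division by repeated subtraction: the quotient 2 q + M goes to register 14, the remainder is the
    first body size and returns to its input cell. Registers 13 and 12 are set to the address and
    index of the second rule. *)
Definition unpack : com :=
  Seq (Blk [:: IConst 1 0; IAdd 1 1 5; ISub 0 0 2; IConst 14 0; ISub 19 3 0])
  (Seq (While 19 (Blk [:: ISub 3 3 0; ISub 3 3 2; IAdd 14 14 2; ISub 19 3 0]))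
       (Blk [:: IAdd 13 1 2; IAdd 13 13 2; IAdd 13 13 2; IStore 13 3;
                IAdd 13 13 2; IAdd 13 13 3; IConst 12 1])).

(* Register 19 becomes 0 iff the rule at register 13 and the next one are both (0, empty). *)
Definition sum4 : seq instr :=
  [:: ILoad 19 13; IAdd 20 13 2; ILoad 18 20; IAdd 19 19 18; IAdd 20 20 2; ILoad 18 20;
      IAdd 19 19 18; IAdd 20 20 2; ILoad 18 20; IAdd 19 19 18].
Definition advance : seq instr :=
  [:: IAdd 20 13 2; ILoad 18 20; IAdd 13 13 18; IAdd 13 13 2; IAdd 13 13 2; IAdd 12 12 2].
Definition scan : com := Seq (Blk sum4) (While 19 (Seq (Blk advance) (Blk sum4))).

(** Subtracting the index reached by [scan] leaves 2 q plus 0 or 1; halving puts q in register 15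
    and the parity in register 14. *)
Definition split_count : com :=
  Seq (Blk [:: ISub 14 14 12; ISub 19 14 2; IConst 15 0])
      (While 19 (Blk [:: ISub 14 14 2; ISub 14 14 2; IAdd 15 15 2; ISub 19 14 2])).
(** Adds the parity to the index reached, which gives the number of rules, and writes back the head
    of the first rule, the last missing input cell that the search reads. *)
Definition setup : seq instr :=
  [:: IConst 4 0; IAdd 4 12 14; IAdd 13 1 2; IAdd 13 13 2; IStore 13 15; IAdd 5 1 1; IAdd 6 5 1;
      IAdd 7 6 1; IAdd 8 7 1; IConst 9 0; IConst 10 1; IConst 11 1].

Definition prelude : com :=
  Seq pack (Seq save (Seq move_input (Seq unpack (Seq scan (Seq split_count (Blk setup)))))).

Lemma erules_cat s t : erules (s ++ t) = erules s ++ erules t.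
Proof. by rewrite /erules map_cat flatten_cat. Qed.

(** * Correctness and cost of the relocation *)

Section Prelude.
Variables (n q1 : nat) (es1 : seq nat) (rs' : seq (nat * seq nat)).
Let rs := (q1, es1) :: rs'.
Hypotheses (q1n : q1 < n) (rs_size : all (fun r => size r.2 <= n) rs).

Definition input : memory := nth 0 (n :: size rs :: erules rs).
Definition wpack : nat := 2 * q1 + size rs.
Definition upack : nat := size es1 + n.+1 * wpack.
Definition far : nat := 16 * upack.

Let size_es1 : size es1 <= n. Proof. by case/andP: rs_size. Qed.

(** A rule fills at most n + 2 cells, so M rules fill at most M (n + 2), while u is at least M (n +
    1) with M and n positive. *)
Lemma far_bound : [/\ 24 <= far, n < far & size (erules rs) + 6 <= far].
Proof.
have H s : all (fun r => size r.2 <= n) s -> size (erules s) <= size s * n.+2.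
  elim: s => [|[q es] s IH] //= /andP[le /IH]; rewrite /erules /= size_cat -/(erules s); lia.
have := H _ rs_size; rewrite /far /upack /wpack.
have : 0 < size rs by [].
by split; nia.
Qed.

Lemma packP : sx pack input (4 + (wpack * (2 + 2) + 1)) (fun m =>
  [/\ m 0 = n.+1, m 3 = upack & forall a, 4 <= a -> m a = input a]).
Proof.
pose I i m := [/\ m 0 = n.+1, m 1 = 1, m 2 = i, m 3 + n.+1 * i = upack &
  forall a, 4 <= a -> m a = input a].
apply: sx_seq; apply: sx_blk => //.
apply: (@sx_weak _ _ _ _ (I 0)) (leqnn _) _; last first.
  by move=> m [H0 H1 H2 H3 H4]; split=> //; lia.
apply: (@sx_while 2 _ 2 I wpack) => [m [] //|i m [H0 H1 H2 H3 H4]|]; last first.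
  have i0 : input 0 = n by []. have i1 : input 1 = size rs by [].
  have i2 : input 2 = q1 by []. have i3 : input 3 = size es1 by [].
  split; try (by upds; rewrite ?i0 ?i1 ?i2 ?i3 /upack /wpack; lia).
  by move=> a le; upds.
split; first by rewrite H2.
apply: (@sx_blk [:: _; _]) => //; split; try (by upds; lia).
by move=> a le; upds; apply: H4.
Qed.

Lemma save_rangeP k j m F : k + j <= F -> m 2 = 1 -> 2 < k -> m 1 = F + k ->
  let m' := evalb m (save_range k j) in
  [/\ m' 1 = F + k + j, forall i, k <= i < k + j -> m' (F + i) = m i &
      forall a, a != 1 -> (a < F + k) || (F + k + j <= a) -> m' a = m a].
Proof.
elim: j k m => [|j IH] k m le E2 gk E1 /=.
  by rewrite addn0; split=> // i; lia.
rewrite /save_range /= -/(save_range _ _) -/(evalb _ _).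
set m1 := upd _ _ _.
have F1 : m1 1 = F + k.+1 by rewrite /m1; upds; lia.
have Fk : m1 (F + k) = m k by rewrite /m1; upds.
have FF a : a != 1 -> a != F + k -> m1 a = m a by move=> *; rewrite /m1; upds.
have [||||H1 H2 H3] := IH k.+1 m1; try lia; first by rewrite FF //; lia.
split; first by rewrite H1; lia.
- move=> i lti; have [->|ne] := eqVneq i k; first by rewrite H3 ?Fk //; lia.
  by rewrite H2 ?FF //; lia.
- by move=> a na lta; rewrite H3 ?FF //; lia.
Qed.

Lemma saveP m : m 0 = n.+1 -> m 3 = upack -> (forall a, 4 <= a -> m a = input a) ->
  sx save m (9 + 40) (fun m' => [/\ m' 0 = n.+1, m' 1 = far + 24, m' 2 = 1, m' 3 = upack &
    (forall i, 4 <= i < 24 -> m' (far + i) = input i) /\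
    (forall a, 24 <= a -> (a < far + 4) || (far + 24 <= a) -> m' a = input a)]).
Proof.
move=> E0 E3 E; have [gF ltF leF] := far_bound.
apply: sx_seq; apply: sx_blk => //; set m1 := evalb _ _.
have F1 : m1 1 = far + 4 by rewrite /m1; upds; rewrite /far; lia.
have F2 : m1 2 = 1 by rewrite /m1; upds.
have FF a : a != 1 -> a != 2 -> m1 a = m a by move=> *; rewrite /m1; upds.
have [||||H1 H2 H3] := @save_rangeP 4 20 m1 far; try lia.
apply: (@sx_blk (save_range 4 20)) => //; split.
- by rewrite H3 ?FF //; lia.
- by rewrite H1; lia.
- by rewrite H3 //; lia.
- by rewrite H3 ?FF //; lia.
split=> [i lti|a ga la]; first by rewrite H2 ?FF ?E //; lia.
by rewrite H3 ?FF ?E //; lia.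
Qed.

Lemma input0 a : size (erules rs) + 2 <= a -> input a = 0.
Proof. by move=> le; rewrite /input nth_default //=; move: le; rewrite /=; lia. Qed.

(** [lo] is the first input position known to be in place. The zeros from [2 * far] on initialise
    the status array and the sentinel. *)
Definition shifted (lo : nat) (m : memory) : Prop :=
  (forall i, lo <= i < far -> m (far + i) = input i) /\ (forall a, 2 * far <= a -> m a = 0).

Lemma move_inputP m : m 0 = n.+1 -> m 1 = far + 24 -> m 2 = 1 -> m 3 = upack ->
  (forall i, 4 <= i < 24 -> m (far + i) = input i) ->
  (forall a, 24 <= a -> (a < far + 4) || (far + 24 <= a) -> m a = input a) ->
  sx move_input m (6 + (far * (5 + 2) + 1)) (fun m' =>
    [/\ m' 0 = n.+1, m' 2 = 1, m' 3 = upack, m' 5 = far & shifted 4 m']).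
Proof.
move=> E0 E1 E2 E3 ES E; have [gF ltF leF] := far_bound.
pose I i m' := [/\ [/\ m' 0 = n.+1, m' 1 = far + m' 12, m' 2 = 1, m' 3 = upack & m' 5 = far],
  m' 13 = i, m' 12 + i = far /\ 24 <= m' 12,
  forall i, 4 <= i < m' 12 -> m' (far + i) = input i &
  forall a, 24 <= a -> (a < far + 4) || (far + m' 12 <= a) -> m' a = input a].
apply: sx_seq; apply: sx_blk => //.
apply: (@sx_weak _ _ ((far - 24) * (5 + 2) + 1) _ (I 0)); last 2 first.
- by rewrite leq_add2r leq_mul2r leq_subr orbT.
- move=> m' [[H0 H1 H2 H3 H5] _ [H12 _] HS H]; rewrite addn0 in H12; rewrite H12 in HS H.
  by split=> //; split=> // a le; rewrite H ?input0 //; lia.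
apply: (@sx_while 13 _ 5 I (far - 24))
  => [m' [] //|i m' [[H0 H1 H2 H3 H5] H13 [H12 L12] HS H]|]; last first.
  have F5 : m 3 + m 3 + (m 3 + m 3) + (m 3 + m 3 + (m 3 + m 3)) + (m 3 + m 3 + (m 3 + m 3)
     + (m 3 + m 3 + (m 3 + m 3))) = far by rewrite /far; lia.
  split; try (by upds; lia).
  - by split; upds; lia.
  - by move=> i; upds => lti; apply: ES.
  - by move=> a ga; upds => la; apply: E.
split; first by rewrite H13.
apply: (@sx_blk move_body) => //; set m1 := evalb _ _.
have F12 : m1 12 = (m' 12).+1 by rewrite /m1; upds; lia.
have Fn : m1 (far + m' 12) = input (m' 12).
  by rewrite /m1; upds; rewrite H //; lia.
have FF a : 24 <= a -> a != far + m' 12 -> m1 a = m' a by move=> *; rewrite /m1; upds.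
split.
- by split; rewrite ?F12 /m1; upds; lia.
- by rewrite /m1; upds; lia.
- by rewrite F12; lia.
- move=> j ltj; have [->//|ne] := eqVneq j (m' 12).
  by rewrite FF ?HS //; lia.
- by move=> a ga la; rewrite FF; [apply: H | |]; lia.
Qed.

Lemma unpackP m : m 0 = n.+1 -> m 2 = 1 -> m 3 = upack -> m 5 = far -> shifted 4 m ->
  sx unpack m (5 + (wpack * (4 + 2) + 1 + 7)) (fun m' =>
    [/\ [/\ m' 0 = n, m' 1 = far & m' 2 = 1], m' 12 = 1, m' 13 = far + 4 + size es1,
      m' 14 = wpack & shifted 3 m']).
Proof.
move=> E0 E2 E3 E5 [ES EZ]; have [gF ltF leF] := far_bound.
pose I i m' := [/\ [/\ m' 0 = n, m' 1 = far & m' 2 = 1], m' 3 = size es1 + n.+1 * i,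
  m' 14 + i = wpack, m' 19 = m' 3 - n & forall a, 24 <= a -> m' a = m a].
apply: sx_seq; apply: sx_blk => //; apply: sx_seq.
apply: (@sx_weak _ _ _ _ (I 0)) (leqnn _) _; last first.
  move=> m1 [[H0 H1 H2] H3 H14 H19 H]; rewrite muln0 addn0 in H3.
  apply: sx_blk => //; split; try (by upds; lia).
    by split; upds; lia.
  split=> [i lti|a le]; last by upds; rewrite H ?EZ //; lia.
  have [->|ne] := eqVneq i 3; first by upds.
  by upds; rewrite H ?ES //; lia.
apply: (@sx_while 19 _ 4 I wpack) => [m1 [_ H3 _ -> _]|i m1 [[H0 H1 H2] H3 H14 H19 H]|].
- by rewrite H3; have := size_es1; lia.
- split; first by rewrite H19 H3; lia.
  apply: (@sx_blk [:: _; _; _; _]) => //; split; try (by upds; lia).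
    by split; upds.
  by move=> a le; upds; apply: H.
- split; try (by upds; rewrite ?E3 ?/upack; lia).
    by split; upds; lia.
  by move=> a le; upds.
Qed.

Definition offset (i : nat) : nat := size (erules (take i rs)) + 2.

Definition sum_at (p : nat) : nat := input p + input p.+1 + input p.+2 + input p.+3.

Lemma input_rule i r0 : i < size rs -> let r := nth r0 rs i in
  [/\ input (offset i) = r.1, input (offset i).+1 = size r.2
    & offset i.+1 = offset i + size r.2 + 2].
Proof.
move=> lti; set r := nth r0 rs i => /=.
have S : seg input 2 (erules rs) by [].
move: S; rewrite -{1}(cat_take_drop i rs) erules_cat => /seg_cat[_].
rewrite (drop_nth r0 lti) -/r /erules /= -/(erules _) addnC => /seg_cons[-> /seg_cons[-> _]].
split=> //; rewrite /offset (take_nth r0 lti) -cats1 erules_cat size_cat -/r.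
by rewrite /erules /= size_cat /=; lia.
Qed.

Lemma offset_size i : size rs <= i -> offset i = size (erules rs) + 2.
Proof. by move=> le; rewrite /offset take_oversize. Qed.

Lemma offset_le i : offset i <= size (erules rs) + 2.
Proof. by rewrite /offset -{2}(cat_take_drop i rs) erules_cat size_cat; lia. Qed.

(** The index at which [scan] stops: a final rule (0, empty) looks like the zeros behind the input.
    The test [1 < size rs] is there because the scan starts at the second rule. *)
Definition last_index : nat :=
  if (1 < size rs) && (sum_at (offset (size rs).-1) == 0) then (size rs).-1 else size rs.

Hypothesis rs_uniq : uniq rs.

(* As the rules are distinct, only the last one can be followed by nothing but zeros. *)
Lemma last_indexP : [/\ 0 < last_index, last_index <= size rs <= last_index.+1,
  sum_at (offset last_index) = 0 &
  forall i, 0 < i < last_index -> sum_at (offset i) != 0].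
Proof.
have lt0 : 0 < size rs by [].
have lastE : (last_index == size rs) || ((1 < size rs) && (last_index == (size rs).-1)).
  by rewrite /last_index; case: ifP => [/andP[-> _]|_]; rewrite eqxx ?orbT.
have sumE : sum_at (offset last_index) = 0.
  rewrite /last_index; case: ifP => [/andP[_ /eqP]//|_].
  by rewrite offset_size // /sum_at !input0 //; lia.
split=> //; try lia.
move=> i /andP[i0 lti]; apply/negP => /eqP s0.
have [E|lt] : i = (size rs).-1 \/ i.+1 < size rs by lia.
  move: lti; rewrite /last_index -E s0 eqxx andbT; case: ifP; lia.
pose r0 : nat * seq nat := (0, [::]).
have [|E1 E2 E3] := @input_rule i r0; first lia.
have [E4 E5 _] := @input_rule i.+1 r0 lt.
have z2 : size (nth r0 rs i).2 = 0 by rewrite -E2; move: s0; rewrite /sum_at; lia.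
have z1 : (nth r0 rs i).1 = 0 by rewrite -E1; move: s0; rewrite /sum_at; lia.
rewrite z2 addn0 addn2 in E3; rewrite E3 in E4 E5.
have z4 : (nth r0 rs i.+1).1 = 0 by rewrite -E4; move: s0; rewrite /sum_at; lia.
have z5 : size (nth r0 rs i.+1).2 = 0 by rewrite -E5; move: s0; rewrite /sum_at; lia.
have nilE r : r.1 = 0 -> size r.2 = 0 -> r = r0 by case: r => a [|b s] //= ->.
have := nth_uniq r0 (ltnW lt) lt rs_uniq.
rewrite (nilE _ z1 z2) (nilE _ z4 z5) eqxx; lia.
Qed.

Lemma sum4P m i : m 2 = 1 -> shifted 3 m -> 0 < i -> m 13 = far + offset i ->
  let m' := evalb m sum4 in
  m' 19 = sum_at (offset i) /\ forall a, (a < 18) || (23 < a) -> m' a = m a.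
Proof.
move=> E2 [ES EZ] i0 E13; have [gF ltF leF] := far_bound; have leO := offset_le i.
(* Input position 2 is not restored yet, but all rules after the first lie beyond it. *)
have geO : 2 < offset i by case: i i0 {E13 leO} => [//|i] _; rewrite /offset /= /erules /= addn2.
have rd k : k < 4 -> m (m 13 + k) = input (offset i + k).
  by move=> ltk; rewrite -ES; [congr m | ]; lia.
have r0 := rd 0 isT; have r1 := rd 1 isT; have r2 := rd 2 isT; have r3 := rd 3 isT.
rewrite !(addn0, addn1, addn2, addn3) in r0 r1 r2 r3.
have e1 : m 13 + m 2 = (m 13).+1 by lia.
have e2 : (m 13).+1 + m 2 = (m 13).+2 by lia.
have e3 : (m 13).+2 + m 2 = (m 13).+3 by lia.
split; last by move=> a la; upds.
by upds; rewrite e1 e2 e3 r0 r1 r2 r3.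
Qed.

Lemma scanP m : m 0 = n -> m 1 = far -> m 2 = 1 -> m 12 = 1 -> m 13 = far + 4 + size es1 ->
  m 14 = wpack -> shifted 3 m ->
  sx scan m (10 + (size rs * (16 + 2) + 1)) (fun m' =>
    [/\ [/\ m' 0 = n, m' 1 = far & m' 2 = 1], m' 12 = last_index, m' 14 = wpack & shifted 3 m']).
Proof.
move=> E0 E1 E2 E12 E13 E14 ES; have [gF ltF leF] := far_bound.
have [l0 ls lz lnz] := last_indexP.
pose I i m' := [/\ [/\ m' 0 = n, m' 1 = far & m' 2 = 1],
  0 < m' 12 /\ m' 12 + i = last_index, m' 13 = far + offset (m' 12) /\ m' 14 = wpack,
  m' 19 = sum_at (offset (m' 12)) & shifted 3 m'].
have shift_eq m1 m2 : (forall a, (a < 18) || (23 < a) -> m2 a = m1 a) -> shifted 3 m1 -> shifted 3 m2.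
  by move=> E [H1 H2]; split=> [i lti|a le]; rewrite E ?H1 ?H2 //; lia.
have O1 : m 13 = far + offset 1.
  by rewrite E13 /offset /rs /= take0 /erules /= cats0; lia.
apply: sx_seq; apply: sx_blk => //.
have [S19 SF] := @sum4P m 1 E2 ES isT O1.
apply: (@sx_weak _ _ (last_index.-1 * (16 + 2) + 1) _ (I 0)); last 2 first.
- by rewrite leq_add2r leq_mul2r; apply/orP; right; lia.
- by move=> m' [H0 [_ H12] [_ H14] _ HS]; rewrite addn0 in H12.
apply: (@sx_while 19 _ 16 I last_index.-1)
  => [m1 [_ [_]]|i m1 [[H0 H1 H2] [H12 HL] [H13 H14] H19 HS]|].
- by rewrite addn0 => -> _ ->.
- split; first by rewrite H19 lnz //; lia.
  pose r0 : nat * seq nat := (0, [::]).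
  have [|_ R2 R3] := @input_rule (m1 12) r0; first lia.
  apply: (@sx_seq _ _ _ 6 10); apply: sx_blk => //; set m2 := evalb _ _.
  have FF a : a \notin [:: 12; 13; 18; 20] -> m2 a = m1 a.
    by rewrite !inE => la; rewrite /m2; upds.
  have F12 : m2 12 = (m1 12).+1 by rewrite /m2; upds; lia.
  have leO := offset_le (m1 12).
  have geO : 1 < offset (m1 12) by rewrite /offset; lia.
  have F13 : m2 13 = far + offset (m2 12).
    have e : m1 (m1 13 + m1 2) = input (offset (m1 12)).+1.
      by rewrite H13 H2 addn1 -addnS (HS.1) //; lia.
    by rewrite F12 R3 /m2; upds; rewrite e R2; lia.
  have F2 : m2 2 = 1 by rewrite FF.
  have FS : shifted 3 m2.
    by case: HS => HS HZ; split=> [j ltj|a le]; rewrite FF ?HS ?HZ // !inE; lia.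
  have [|G19 GF] := @sum4P m2 (m2 12) F2 FS _ F13; first by rewrite F12.
  apply: (@sx_blk sum4) => //; split; rewrite ?(GF 0) ?(GF 1) ?(GF 2) ?(GF 12) ?(GF 13) ?(GF 14) //.
  + by rewrite F12; lia.
  + exact: shift_eq FS.
split; rewrite ?(SF 0) ?(SF 1) ?(SF 2) ?(SF 12) ?(SF 13) ?(SF 14) ?E12 //.
  by split=> //; lia.
exact: shift_eq ES.
Qed.

Lemma split_countP m : m 0 = n -> m 1 = far -> m 2 = 1 -> m 12 = last_index ->
  m 14 = wpack -> shifted 3 m ->
  sx split_count m (3 + (q1 * (4 + 2) + 1)) (fun m' =>
    [/\ [/\ m' 0 = n, m' 1 = far & m' 2 = 1], m' 12 + m' 14 = size rs, m' 15 = q1 & shifted 3 m']).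
Proof.
move=> E0 E1 E2 E12 E14 ES; have [gF ltF leF] := far_bound.
have [l0 ls _ _] := last_indexP.
pose I i m' := [/\ [/\ m' 0 = n, m' 1 = far & m' 2 = 1], m' 12 + m' 14 = size rs + 2 * i,
  m' 15 + i = q1, m' 19 = m' 14 - 1 & m' 12 = last_index /\ shifted 3 m'].
have shift_eq m1 m2 : (forall a, 24 <= a -> m2 a = m1 a) -> shifted 3 m1 -> shifted 3 m2.
  by move=> E [H1 H2]; split=> [i lti|a le]; rewrite E ?H1 ?H2 //; lia.
apply: sx_seq; apply: sx_blk => //.
apply: (@sx_weak _ _ _ _ (I 0)) (leqnn _) _; last first.
  by move=> m' [H0 H12 H15 _ [_ HS]]; split=> //; lia.
apply: (@sx_while 19 _ 4 I q1) => [m1 [_ H1 _ -> [H2 _]]|i m1 [[H0 H1 H2] H12 H15 H19 [HL HS]]|].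
- by lia.
- split; first by rewrite H19; lia.
  apply: (@sx_blk [:: _; _; _; _]) => //; split; try (by upds; lia).
    by split; upds.
  split; first by upds.
  by apply: shift_eq HS => a le; upds.
split; try (by upds; rewrite ?E14 ?E12 /wpack; lia).
  by split; upds.
split; first by upds.
by apply: shift_eq ES => a le; upds.
Qed.

Lemma setupP m : m 0 = n -> m 1 = far -> m 2 = 1 -> m 12 + m 14 = size rs -> m 15 = q1 ->
  shifted 3 m -> state n far rs 1 [::] (evalb m setup) /\ evalb m setup 11 = 1.
Proof.
move=> E0 E1 E2 E12 E15 [ES EZ]; have [gF ltF leF] := far_bound.
split; last by upds.
set m' := evalb m setup.
have FF a : 24 <= a -> a != far + 2 -> m' a = m a by move=> *; rewrite /m'; upds.
have F2 : m' (far + 2) = q1 by rewrite /m'; upds.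
split; try (by rewrite /m'; upds).
- split; try (by rewrite /m'; upds; lia).
  move=> i lti; have [->|ne] := eqVneq i 0; first by rewrite addn0 F2.
  rewrite FF; try lia.
  by rewrite -addnA ES //; lia.
- by move=> i lti; rewrite FF ?EZ //; lia.
- by rewrite FF ?EZ //; lia.
Qed.

Lemma preludeP : sx prelude input (40 * far + 160)
  (fun m => state n far rs 1 [::] m /\ m 11 = 1).
Proof.
have [gF ltF leF] := far_bound.
have bw : wpack <= far /\ size rs <= far by rewrite /far /upack /wpack; nia.
have wE : wpack = 2 * q1 + size rs by [].
apply: (@sx_weak _ _ (4 + (wpack * (2 + 2) + 1) + (9 + 40 + (6 + (far * (5 + 2) + 1) +
  (5 + (wpack * (4 + 2) + 1 + 7) + (10 + (size rs * (16 + 2) + 1) +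
  (3 + (q1 * (4 + 2) + 1) + 12))))))); last 2 first.
- by lia.
- by move=> m; exact.
apply: sx_seq; apply: sx_weak packP (leqnn _) _ => m1 [H0 H3 H].
apply: sx_seq; apply: sx_weak (saveP H0 H3 H) (leqnn _) _
  => {H0 H3 H} m2 [H0 H1 H2 H3 [HS H]].
apply: sx_seq; apply: sx_weak (move_inputP H0 H1 H2 H3 HS H) (leqnn _) _
  => {H0 H1 H2 H3 HS H} m3 [H0 H2 H3 H5 HS].
apply: sx_seq; apply: sx_weak (unpackP H0 H2 H3 H5 HS) (leqnn _) _
  => {H0 H2 H3 H5 HS} m4 [[H0 H1 H2] H12 H13 H14 HS].
apply: sx_seq; apply: sx_weak (scanP H0 H1 H2 H12 H13 H14 HS) (leqnn _) _
  => {H0 H1 H2 H12 H13 H14 HS} m5 [[H0 H1 H2] H12 H14 HS].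
apply: sx_seq; apply: sx_weak (split_countP H0 H1 H2 H12 H14 HS) (leqnn _) _
  => {H0 H1 H2 H12 H14 HS} m6 [[H0 H1 H2] H12 H15 HS].
apply: sx_blk => //; exact: setupP.
Qed.

End Prelude.

(** * The program *)

(* Without rules the hypothesis n <= l forces n = 0. *)
Definition enumerate : com := If 1 (Seq prelude (While 11 visit)) (Out 0 0).

(** Since q and n are at most l, u is at most 7 n l. Relocation then takes 4480 n l, the search 1116
    n l, and 162 is constant. *)
Lemma budget n l M q1 a1 : q1 < n -> a1 <= n -> M <= l -> n <= l -> 0 < M ->
  2 + 40 * (16 * (a1 + n.+1 * (2 * q1 + M))) + 160 + (3 * n + 6) * (l * 40 + n * 24 + 60)
  <= 90 * 90 * (n * l + 1).
Proof.
move=> ltq lea leM len M0.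
have H1 : n.+1 * (2 * q1 + M) <= 6 * (n * l).
  apply: (@leq_trans (2 * n * (3 * l))); last by lia.
  by apply: leq_mul; lia.
have H2 : a1 <= n * l by apply: leq_trans lea _; rewrite -{1}[n]muln1 leq_mul2l; lia.
have H3 : (3 * n + 6) * (l * 40 + n * 24 + 60) <= 9 * n * (124 * l) by apply: leq_mul; lia.
have H4 : 1 <= n * l by rewrite muln_gt0; lia.
lia.
Qed.

Lemma enumerate_run n (R : seq (rule n)) : uniq R -> n <= lR R ->
  exists ev m', [/\ exec enumerate (nth 0 (encode R)) ev m',
    outputs ev = leaves n (raw_rules R) n [::]
  & all (fun g => g <= 90 * 90 * (n * lR R + 1)) (gaps 0 ev)].
Proof.
move=> U leR; rewrite encodeE.
have [E0|] := eqVneq (size R) 0.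
  have n0 : n = 0 by move: leR; rewrite (size0nil E0) /lR big_nil; lia.
  subst n.
  (* Cell 0 holds n = 0, so [Out 0 0] outputs the empty list, which stands for the only subset. *)
  eexists; exists (nth 0 (0 :: size R :: erules (raw_rules R))); split.
  - by apply: EIfF => //; exact: EOut.
  - by [].
  - by rewrite mul0n.
rewrite -lt0n => R0.
have leRl : size R <= lR R.
  by rewrite -sum1_size; apply: leq_sum => r _; rewrite addn1.
have nzR : size R != 0 by rewrite -lt0n.
have := raw_lt R; have := uniq_raw U; have := weight_raw R.
have : all (fun r => size r.2 <= n) (raw_rules R).
  rewrite all_map; apply/allP => r _ /=; rewrite size_map -cardE.
  by rewrite -[leqRHS]card_ord max_card.
have : size (raw_rules R) = size R by rewrite size_map.
case: (raw_rules R) => [|[q1 es1] rs'] sR rs_size weightE rs_uniq rs_lt.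
  by rewrite -sR in R0.
have q1n : q1 < n by case/andP: (rs_lt) => /andP[].
have [gF ltF leF] := far_bound q1n rs_size.
have [e1 [m1 [X1 O1 C1 [S1 E11]]]] := preludeP q1n rs_size rs_uniq.
have szF : size (erules ((q1, es1) :: rs')) + 2 <= far n q1 es1 rs' by lia.
set B := 90 * 90 * (n * lR R + 1).
(* The first test and the whole relocation are charged to the first gap. *)
have [|e2 [m2 [X2 O2 [b T2 leb]]]] := main_run (B := B) (a := 1 + cost e1) gF ltF szF rs_lt S1 E11.
  have a1n : size es1 <= n by case/andP: rs_size.
  have := budget q1n a1n leRl leR R0; rewrite -/B -sR.
  move: C1; rewrite /vcost weightE /far /upack /wpack.
  move: (_ * (lR R * 40 + _ + _)) (_ * (_ + _)); lia.
exists ((1, None) :: rcons (e1 ++ e2) (1, None)), m2; split.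
- apply: EIfT; first by [].
  by apply: ESeq X2; rewrite -sR.
- by rewrite -cats1 !(outputs_none, outputs_cat) O1 O2 cats0.
apply: (timed_gaps (b := b.+1)) => //; rewrite -cats1 /= -catA.
apply: (timed_cat (b := 1 + cost e1)); first exact: timed_silent.
by apply: timed_cat T2 _; rewrite /= addn1.
Qed.

Theorem theorem3p5 :
  exists (P : seq instr) (c : nat),
    forall (n : nat) (R : seq (rule n)),
      uniq R -> n <= lR R ->
      exists fuel : nat,
        let ev := (run P fuel (init R)).1 in
        [/\ halted P (run P fuel (init R)).2,
            uniq [seq decode n v | v <- outputs ev],
            (forall K : {set 'I_n},
                K \in [seq decode n v | v <- outputs ev] <-> inA R K)
          & all (fun g => g <= c * (n * lR R + 1)) (gaps 0 ev)].
Proof.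
exists (compile 0 enumerate), (90 * 90) => n R U leR.
have [ev [m' [X O G]]] := enumerate_run U leR.
have [fuel [Eev H]] := comp_run X.
exists fuel; rewrite /init; cbv zeta; rewrite Eev O.
by have [uK mK] := leaves_enum R; split.
Qed.
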